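(* Let $\mathcal H=(Q,\Sigma,\Psi)$ be a Hidden Markov Model, let $\pi_1,\pi_2$ be initial distributions, and let $\ell\in\Lambda_{\pi_1,\pi_2}$ be a likelihood exponent for $\pi_1,\pi_2$. (1) If $\ell\in(-\infty,0)$, then $\mathbb E_{\pi_2}[N_{\alpha,\beta}\mid E_\ell]\sim\frac{\ln\alpha}{\ell}$ as $\alpha,\beta\to0$. (2) If $\ell=0$, then there exist $\alpha,\beta>0$ (in $(0,1)$) such that $\mathbb E_{\pi_2}[N_{\alpha,\beta}\mid E_\ell]=\infty$. (3) If $\ell=-\infty$, then $\sup_{\alpha,\beta}\mathbb E_{\pi_2}[N_{\alpha,\beta}\mid E_\ell]<\infty$, the supremum being over $\alpha,\beta\in(0,1)$.
   Context: A Hidden Markov Model (HMM) is a triple $\mathcal H=(Q,\Sigma,\Psi)$ where $Q$ is a finite set of states, $\Sigma$ a finite set of observations (letters), and $\Psi:\Sigma\to[0,1]^{Q\times Q}$ is such that $\sum_{a\in\Sigma}\Psi(a)$ is (row-)stochastic. $\Psi$ extends to $\Sigma^*$ by $\Psi(a_1\cdots a_n)=\Psi(a_1)\cdots\Psi(a_n)$, $\Psi(\varepsilon)=I$. Vectors in $\mathbb R^Q$ are row vectors and $\|\cdot\|$ is the $\ell_1$ norm. An initial distribution is a vector $\pi\in[0,1]^Q$ with $\|\pi\|=1$. $\mathbb P_\pi$ is the unique probability measure on runs $Q(\Sigma Q)^\omega$ (with the $\sigma$-algebra generated by cylinder sets) with $\mathbb P_\pi(q_0a_1q_1\cdots a_nq_n(\Sigma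 Q)^\omega)=\pi_{q_0}\prod_{i=1}^n\Psi(a_i)_{q_{i-1},q_i}$; for $E\subseteq\Sigma^\omega$, $\mathbb P_\pi(E)$ denotes the probability that the emitted word $a_1a_2\cdots$ lies in $E$, and $\mathbb E_\pi$ is the corresponding expectation. Thus $\mathbb P_\pi(w\Sigma^\omega)=\|\pi\Psi(w)\|$ for $w\in\Sigma^*$. For $w\in\Sigma^\omega$ let $w_n$ be its length-$n$ prefix. The likelihood ratio is $L_n(w)=\|\pi_1\Psi(w_n)\|/\|\pi_2\Psi(w_n)\|$ (well defined for all $n$, $\mathbb P_{\pi_2}$-almost surely), with $\ln0=-\infty$. For $\ell\in[-\infty,0]$ let $E_\ell=\{\lim_{n\to\infty}\frac1n\ln L_n=\ell\}$. The number $\ell$ is a likelihood exponent for $\pi_1,\pi_2$ if $\mathbb P_{\pi_2}(E_\ell)>0$; $\Lambda_{\pi_1,\pi_2}$ is the set of these. For $\alpha,\beta\in(0,1)$ put $A=\ln\frac{\alpha}{1-\beta}$, $B=\ln\frac{1-\alpha}{\beta}$, and $N_{\alpha,\beta}=\min\{n\in\mathbb N\mid\ln L_n\notin[A,B]\}\in\mathbb N\cup\{\infty\}$ (the stopping time of the Sequential Probability Ratio Test), where $\mathbb N\ni0$ and $\min\emptyset=\infty$. For functions $f,g$ of $\alpha,\beta$, ''$f(\alpha,\beta)\sim g(\alpha,\beta)$ as $\alpha,\beta\to0$'' means: for all $\epsilon>0$ there is $\delta>0$ such that for all $\alpha,\beta\in(0,\delta)$ we have $f(\alpha,\beta)/g(\alpha,\beta)\in[1-\epsilon,1+\epsilon]$.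 *)

(* Defs.v *)
(* Sequential probability ratio test for hidden Markov models, in MathComp-Analysis. *)
From HB Require Import structures.
From mathcomp Require Import all_boot all_order all_algebra.
From mathcomp Require Import all_classical all_reals all_analysis.

Set Implicit Arguments.
Unset Strict Implicit.
Unset Printing Implicit Defensive.

Import Order.TTheory GRing.Theory Num.Theory.
Import numFieldNormedType.Exports.

Local Open Scope classical_set_scope.
Local Open Scope ring_scope.

(* Vectors and matrices over a finite type Q are indexed by 'I_#|Q|; the
   coordinate of a state q is enum_rank q. *)

Definition norm1 (R : realType) (n : nat) (v : 'rV[R]_n) : R :=
  \sum_j `|v ord0 j|.

Definition stochastic (R : realType) (n : nat) (M : 'M[R]_n) : Prop :=
  (forall i j, 0 <= M i j) /\ (forall i, \sum_j M i j = 1).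

Record hmm (R : realType) (Q S : finType) := Hmm {
  hmm_mx :> S -> 'M[R]_#|Q| ;
  hmm_mx_unit : forall a i j, 0 <= hmm_mx a i j <= 1 ;
  hmm_stochastic : stochastic (\sum_a hmm_mx a) }.

Record init_dist (R : realType) (Q : finType) := InitDist {
  dist_row :> 'rV[R]_#|Q| ;
  dist_unit : forall j, 0 <= dist_row ord0 j <= 1 ;
  dist_norm1 : norm1 dist_row = 1 }.

Definition word_mx (R : realType) (Q S : finType) (H : hmm R Q S) (w : seq S) :
    'M[R]_#|Q| :=
  \big[mulmx/1%:M]_(a <- w) H a.

(* A run q_0 a_1 q_1 a_2 q_2 ... is the pair (i |-> q_i, i |-> a_(i+1)). The
   parameters H and pi guarantee that runs exist, which is what the Pointed
   instance required of measurable types rests on. *)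
Definition runs (R : realType) (Q S : finType)
  (H : hmm R Q S) (pi : init_dist R Q) : Type := ((nat -> Q) * (nat -> S))%type.

Section RunsPointed.
Context (R : realType) (Q S : finType) (H : hmm R Q S) (pi : init_dist R Q).

Lemma state_inhabited : exists q : Q, true.
Proof.
have [/existsP[q _]|/existsPn noQ] := boolP [exists q : Q, true].
  by exists q.
have := dist_norm1 pi; rewrite /norm1 big1 => [/esym/eqP|j _].
  by rewrite oner_eq0.
by have := noQ (enum_val j).
Qed.

Lemma letter_inhabited : exists a : S, true.
Proof.
have [/existsP[a _]|/existsPn noS] := boolP [exists a : S, true].
  by exists a.
have [q _] := state_inhabited.
have := (hmm_stochastic H).2 (enum_rank q); rewrite big1 => [/esym/eqP|j _].
  by rewrite oner_eq0.
by rewrite big1 ?mxE// => a; have := noS a.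
Qed.

HB.instance Definition _ := Choice.copy (runs H pi) ((nat -> Q) * (nat -> S))%type.
HB.instance Definition _ := isPointed.Build (runs H pi)
  (fun=> xchoose state_inhabited, fun=> xchoose letter_inhabited).

End RunsPointed.

Section HmmRuns.
Context (R : realType) (Q S : finType) (H : hmm R Q S).

(* The set of runs that extend q 0, a 0, q 1, ..., a (n - 1), q n; the values
   of q and a at larger indices are irrelevant. *)
Definition cylinder (pi : init_dist R Q) (n : nat) (q : nat -> Q) (a : nat -> S) :
    set (runs H pi) :=
  [set r | (forall i, (i <= n)%N -> r.1 i = q i) /\
           (forall i, (i < n)%N -> r.2 i = a i)].

Definition cylinders (pi : init_dist R Q) : set (set (runs H pi)) :=
  [set C | exists n q a, C = @cylinder pi n q a].

Definition run_space (pi : init_dist R Q) := g_sigma_algebraType (@cylinders pi).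

(* Cylinders and the empty set form a generating pi-system, so at most one P
   satisfies this. *)
Definition is_run_measure (pi : init_dist R Q)
    (P : probability (run_space pi) R) : Prop :=
  forall (n : nat) (q : nat -> Q) (a : nat -> S),
    P (@cylinder pi n q a) =
    (pi ord0 (enum_rank (q 0%N)) *
     \prod_(i < n) H (a i) (enum_rank (q i)) (enum_rank (q i.+1)))%:E.

Definition emitted (pi : init_dist R Q) (r : run_space pi) : nat -> S := r.2.

Definition word_prefix (w : nat -> S) (n : nat) : seq S := mkseq w n.

(* By the convention x / 0 = 0 this is 0 where the denominator vanishes, which
   happens with probability 0 under pi2. *)
Definition likelihood_ratio (pi1 pi2 : init_dist R Q) (n : nat) (w : nat -> S) : R :=
  norm1 (pi1 *m word_mx H (word_prefix w n)) / norm1 (pi2 *m word_mx H (word_prefix w n)).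

(* lne is the extended logarithm, with lne 0 = -oo. *)
Definition ln_ratio (pi1 pi2 : init_dist R Q) (n : nat) (w : nat -> S) : \bar R :=
  lne (likelihood_ratio pi1 pi2 n w)%:E.

Definition exponent_event (pi1 pi2 : init_dist R Q) (l : \bar R) :
    set (nat -> S) :=
  [set w | ((n%:R^-1)%:E * ln_ratio pi1 pi2 n w)%E @[n --> \oo] --> l].

Definition likelihood_exponents (pi1 pi2 : init_dist R Q)
    (P2 : probability (run_space pi2) R) : set (\bar R) :=
  [set l | (l <= 0)%E /\
           (0 < P2 (@emitted pi2 @^-1` exponent_event pi1 pi2 l))%E].

(* The infimum of the empty set is +oo. *)
Definition sprt_time (pi1 pi2 : init_dist R Q) (alpha beta : R) (w : nat -> S) :
    \bar R :=
  ereal_inf [set (n%:R)%:E | n in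
    [set n : nat | ~ ((ln (alpha / (1 - beta)))%:E <= ln_ratio pi1 pi2 n w
                      <= (ln ((1 - alpha) / beta))%:E)%E]].

Definition cond_expectation (pi : init_dist R Q)
    (P : probability (run_space pi) R) (X : (nat -> S) -> \bar R)
    (E : set (nat -> S)) : \bar R :=
  ((\int[P]_(r in @emitted pi @^-1` E) X (emitted r)) /
   P (@emitted pi @^-1` E))%E.

Definition cond_sprt_time (pi1 pi2 : init_dist R Q)
    (P2 : probability (run_space pi2) R) (l : \bar R) (alpha beta : R) : \bar R :=
  cond_expectation P2 (sprt_time pi1 pi2 alpha beta) (exponent_event pi1 pi2 l).

End HmmRuns.

Definition asymp_equiv (R : realType) (f g : R -> R -> \bar R) : Prop :=
  forall eps : R, 0 < eps -> exists2 delta : R, 0 < delta &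
    forall alpha beta : R, 0 < alpha < delta -> 0 < beta < delta ->
      ((1 - eps)%:E <= f alpha beta / g alpha beta <= (1 + eps)%:E)%E.

(* Main.v *)
Require Import Defs.
From mathcomp Require Import all_boot all_order all_algebra.
From mathcomp Require Import all_classical all_reals all_analysis.
From mathcomp Require Import measurable_realfun.
From mathcomp Require Import ring lra.

(** The test is undecided at time n exactly while the likelihood ratio L_k has
stayed in the interval from alpha / (1 - beta) to (1 - alpha) / beta for all
k <= n, so the expectation of N on the exponent event E_l is the series over n
of the probabilities of being in E_l and still undecided at time n
(cond_sprt_timeE).  The three claims are estimates of that series.

The central estimate is eventually_below_deviation: when theta < theta', the
probability that L_k <= e^(theta k) from some time on, and that nevertheless
L_n > e^(theta' n), decays exponentially in n.  For l in (-oo, 0), an undecided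
run at time n has L_n >= alpha, which is such a deviation as soon as n exceeds
about (ln alpha) / l; the remaining terms of the series therefore have a sum
bounded independently of alpha and beta (exit_series_upper).  For l = -oo,
even a nonzero ratio is such a deviation, as it is at least k c^n
(word_ratio_lb); so the whole series is bounded independently of alpha and beta
(exit_series_Ny_bounded).  The lower bound for l in (-oo, 0) is
softer: a run of exponent l stays in a tube e^(- m + y n) <= L_n <= e^m with y
close to l, and in the tube no decision occurs before about (ln alpha) / l steps
(exit_series_lower).

To prove the deviation estimate, follow along a run of the second chain the
pair x = (q, T), where q is the hidden state and T is the support of the first
chain's vector after the same letters.  There are finitely many pairs, and x
determines the future numerators of L up to constant factors, while the future
denominators are bounded below by a constant times the probability of the
letters from q.  Call x pure if, given a suitable path that ends in
x, the bound L_k <= e^(theta k) holds from some time on with conditional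
probability as close to 1 as desired.  From a pair that reaches no pure pair the
bound eventually holds with probability 0 (dead_path); pairs that are neither
pure nor of this kind are left at an exponential rate (stay_prob_decay); and
from a pure pair the moments of L_n of some order s in (0, 1) decay at rate
e^(s theta'') for some theta'' < theta' (pure_entry_affinity and
affinity_decay), so that Markov's inequality applies (pr_above_future).  The
moments are submultiplicative over blocks of letters because only supports and
hidden states are passed from block to block; hence a single block length m
has to be controlled, and the order s = 1 / m makes the bad part of the block
harmless, as the ratio over one block is at most K^m.

For l = 0, let o_n be the sum over the words of length n of the smaller of
their two probabilities.  If o_n does not tend to 0, an optional stopping
argument keeps L in a compact subinterval of the positive reals forever with
positive probability (overlap_le_range); such runs have exponent 0 and are never
decided for small alpha and beta.  If o_n tends to 0, then the moments of order
1/2 are below 1/2 for some block length, hence decay exponentially, and the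
exponent 0 has probability 0 (overlap_bounded_below). *)

Set Implicit Arguments.
Unset Strict Implicit.
Unset Printing Implicit Defensive.

Import Order.TTheory GRing.Theory Num.Theory.
Import numFieldNormedType.Exports.

Local Open Scope classical_set_scope.
Local Open Scope ring_scope.

(** * Sums over words *)

Section Words.
Context (S : finType).

(** Lists rather than tuples, so that sums over words of length m + n split
without casts. *)
Fixpoint words (n : nat) : seq (seq S) :=
  if n is m.+1 then [seq a :: w | a <- enum S, w <- words m] else [:: [::]].

Lemma mem_words n w : (w \in words n) = (size w == n).
Proof.
elim: n w => [|n IH] w /=; first by rewrite inE; case: w.
apply/allpairsP/idP => [[[a v] /= [_ vn ->]]|]; first by rewrite /= eqSS -IH.
case: w => // a w; rewrite /= eqSS -IH => wn.
by exists (a, w); rewrite mem_enum.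
Qed.

Lemma sum_wordsS (V : nmodType) n (F : seq S -> V) :
  \sum_(w <- words n.+1) F w = \sum_a \sum_(w <- words n) F (a :: w).
Proof. by rewrite /= big_allpairs_dep /= big_enum. Qed.

Lemma sum_words_cat (V : nmodType) m n (F : seq S -> V) :
  \sum_(w <- words (m + n)) F w =
  \sum_(u <- words m) \sum_(w <- words n) F (u ++ w).
Proof.
elim: m F => [|m IH] F; first by rewrite /= big_seq1.
by rewrite addSn !sum_wordsS; apply: eq_bigr => a _; rewrite IH.
Qed.

End Words.

(** * Elementary inequalities *)

Section Reals.
Context (R : realType).

Lemma finite_min_pos (I : finType) (P : pred I) (f : I -> R) :
  (forall i, P i -> 0 < f i) ->
  exists2 c : R, 0 < c <= 1 & forall i, P i -> c <= f i.
Proof.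
move=> f_gt0.
suff [c c01 cf] : exists2 c : R, 0 < c <= 1 &
    forall i, i \in enum I -> P i -> c <= f i.
  by exists c => // i; apply: cf; rewrite mem_enum.
elim: (enum I) => [|i s [c /andP[c0 c1] cf]]; first by exists 1 => //; lra.
have [Pi|nPi] := boolP (P i); last first.
  exists c; first by rewrite c0 c1.
  by move=> j; rewrite inE => /orP[/eqP->|js]; [rewrite (negbTE nPi)|exact: cf].
exists (Num.min c (f i)).
  by rewrite lt_min c0 f_gt0//= ge_min c1.
move=> j; rewrite inE ge_min => /orP[/eqP-> _|js Pj].
  by rewrite lexx orbT.
by rewrite cf.
Qed.

Lemma finite_bound (I : finType) (f : I -> nat) : exists N, forall i, (f i <= N)%N.
Proof. by exists (\max_i f i) => i; exact: leq_bigmax. Qed.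

(** t <= t ^ p for t in [0, 1]; take for t the shares of x and y in x + y. *)
Lemma powRD_le (x y p : R) : 0 <= p <= 1 -> 0 <= x -> 0 <= y ->
  (x + y) `^ p <= x `^ p + y `^ p.
Proof.
move=> /andP[p0 p1] x0 y0.
have [->|s_neq0] := eqVneq (x + y) 0.
  have [->|p_neq0] := eqVneq p 0; first by rewrite !powRr0; lra.
  by rewrite powR0// addr_ge0// powR_ge0.
have s_gt0 : 0 < x + y by rewrite lt_neqAle eq_sym s_neq0 addr_ge0.
have part z : 0 <= z -> z <= x + y -> z / (x + y) * (x + y) `^ p <= z `^ p.
  move=> z0 zs.
  have -> : z `^ p = (z / (x + y)) `^ p * (x + y) `^ p.
    by rewrite -powRM ?divfK// ?divr_ge0// ltW.
  rewrite ler_wpM2r ?powR_ge0//.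
  have [->|z_neq0] := eqVneq z 0; first by rewrite mul0r powR_ge0.
  rewrite ger1_powR// divr_gt0//= ?lt_neqAle ?z0 1?eq_sym ?z_neq0//.
  by rewrite ler_pdivrMr ?mul1r.
have := lerD (part x x0 _) (part y y0 _); rewrite lerDl y0 lerDr x0.
by move=> /(_ isT isT); apply: le_trans; rewrite -!mulrDl divff// mul1r.
Qed.

Lemma powR_sum_le (I : Type) (r : seq I) (a : I -> R) (p : R) :
  0 < p <= 1 -> (forall i, 0 <= a i) ->
  (\sum_(i <- r) a i) `^ p <= \sum_(i <- r) (a i) `^ p.
Proof.
move=> /andP[p0 p1] a0; elim: r => [|i r IH].
  by rewrite !big_nil powR0// gt_eqF.
rewrite !big_cons; apply: le_trans (lerD (lexx _) IH).
by rewrite powRD_le ?sumr_ge0// ltW.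
Qed.

(** A weighted geometric mean is at most the maximum.  Summed over words, this
gives what Hoelder's inequality is usually needed for, up to a constant. *)
Lemma powR_interpolate_le (x y s : R) : 0 < s < 1 -> 0 <= x -> 0 <= y ->
  x `^ s * y `^ (1 - s) <= x + y.
Proof.
move=> /andP[s0 s1] x0 y0.
have m0 : 0 <= Num.max x y by rewrite le_max x0.
have xm : x `^ s <= Num.max x y `^ s.
  by rewrite ge0_ler_powR ?nnegrE// ?le_max ?lexx// ltW.
have ym : y `^ (1 - s) <= Num.max x y `^ (1 - s).
  by apply: ge0_ler_powR; rewrite ?nnegrE ?subr_ge0 ?(ltW s1)// le_max lexx orbT.
apply: le_trans (ler_pM _ _ xm ym) _; rewrite ?powR_ge0//.
rewrite -powRD ?subrKC ?oner_eq0// powRr1//.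
by rewrite ge_max lerDl y0 lerDr x0.
Qed.

(** The quotient counts complete blocks of length m; the incomplete one is
absorbed by the a priori bound B. *)
Lemma block_decay (T : Type) (X : T -> Prop) (A : nat -> T -> R) (m : nat) (rho B : R) :
  0 <= rho ->
  (forall n x, X x -> A n x <= B) ->
  (forall n beta, (forall y, X y -> A n y <= beta) ->
     forall x, X x -> A (m + n)%N x <= rho * beta) ->
  forall n x, X x -> A n x <= rho ^+ (n %/ m) * B.
Proof.
move=> rho0 AB contr n x Xx.
rewrite {1}(divn_eq n m); elim: (n %/ m)%N x Xx => [|j IH] x Xx.
  by rewrite mul0n add0n expr0 mul1r AB.
by rewrite mulSn -addnA exprS -mulrA; apply: contr.
Qed.

End Reals.

(** * Products of the letter matrices, supports and affinities *)

Section Matrices.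
Context (R : realType) (Q S : finType) (H : hmm R Q S).
Local Notation M := (word_mx H).
Local Notation state := ('I_#|Q|).

Lemma word_mx_nil : M [::] = 1%:M.
Proof. by rewrite /word_mx big_nil. Qed.

Lemma word_mx_cons a w : M (a :: w) = H a *m M w.
Proof. by rewrite /word_mx big_cons. Qed.

Lemma word_mx_cat u w : M (u ++ w) = M u *m M w.
Proof.
elim: u => [|a u IH] /=; first by rewrite word_mx_nil mul1mx.
by rewrite !word_mx_cons IH mulmxA.
Qed.

Lemma hmm_ge0 a i j : 0 <= H a i j.
Proof. by have /andP[] := hmm_mx_unit H a i j. Qed.

Lemma word_mx_ge0 w i j : 0 <= M w i j.
Proof.
elim: w i j => [|a w IH] i j.
  by rewrite word_mx_nil mxE ler0n.
by rewrite word_mx_cons mxE sumr_ge0// => k _; rewrite mulr_ge0// hmm_ge0.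
Qed.

Lemma word_mx_catE u w i j :
  M (u ++ w) i j = \sum_k M u i k * M w k j.
Proof. by rewrite word_mx_cat mxE. Qed.

Definition row_mass (w : seq S) (q : state) : R := \sum_j M w q j.

Lemma row_mass_ge0 w q : 0 <= row_mass w q.
Proof. by rewrite sumr_ge0// => j _; rewrite word_mx_ge0. Qed.

Lemma row_mass_nil q : row_mass [::] q = 1.
Proof.
rewrite /row_mass word_mx_nil (bigD1 q)//= mxE eqxx big1 ?addr0// => j jq.
by rewrite mxE eq_sym (negbTE jq).
Qed.

Lemma word_mx_le_row_mass w q j : M w q j <= row_mass w q.
Proof.
rewrite /row_mass (bigD1 j)//= lerDl sumr_ge0// => k _.
by rewrite word_mx_ge0.
Qed.

Lemma row_mass_cat u w q :
  row_mass (u ++ w) q = \sum_k M u q k * row_mass w k.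
Proof.
rewrite /row_mass; under eq_bigr do rewrite word_mx_catE.
by rewrite exchange_big; apply: eq_bigr => k _; rewrite -mulr_sumr.
Qed.

Lemma sum_letters_row q : \sum_a \sum_j H a q j = 1.
Proof.
rewrite exchange_big -((hmm_stochastic H).2 q).
by apply: eq_bigr => j _; rewrite summxE.
Qed.

Lemma sum_words_row_mass n q : \sum_(w <- words S n) row_mass w q = 1.
Proof.
elim: n q => [|n IH] q; first by rewrite /= big_seq1 row_mass_nil.
rewrite sum_wordsS -(sum_letters_row q); apply: eq_bigr => a _.
transitivity (\sum_(w <- words S n) \sum_k H a q k * row_mass w k).
  apply: eq_bigr => w _; rewrite -cat1s row_mass_cat; apply: eq_bigr => k _.
  by rewrite word_mx_cons word_mx_nil mulmx1.
by rewrite exchange_big; apply: eq_bigr => k _; rewrite -mulr_sumr IH mulr1.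
Qed.

Lemma row_mass_le1 w q : row_mass w q <= 1.
Proof.
rewrite -(sum_words_row_mass (size w) q).
have : w \in words S (size w) by rewrite mem_words.
move: (words S _) => s; elim: s => // v s IH.
rewrite inE big_cons => /orP[/eqP<-|/IH ws].
  by rewrite lerDl sumr_ge0// => u _; rewrite row_mass_ge0.
by rewrite (le_trans ws)// lerDr row_mass_ge0.
Qed.

Lemma word_mx_cat_gt0 u w i k j : 0 < M u i k -> 0 < M w k j -> 0 < M (u ++ w) i j.
Proof.
move=> u0 w0; rewrite word_mx_catE (bigD1 k)//= ltr_wpDr ?mulr_gt0//.
by rewrite sumr_ge0// => l _; rewrite mulr_ge0 ?word_mx_ge0.
Qed.

Lemma sumr_gt0_ex (I : finType) (F : I -> R) : 0 < \sum_i F i ->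
  (forall i, 0 <= F i) -> exists i, 0 < F i.
Proof.
move=> s0 F0; apply/existsP; apply: contraTT s0 => /existsPn no.
by rewrite -leNgt big1// => i _; apply/eqP; rewrite eq_le F0 andbT leNgt no.
Qed.

Lemma word_mx_cat_gt0P u w i j :
  reflect (exists2 k, 0 < M u i k & 0 < M w k j) (0 < M (u ++ w) i j).
Proof.
apply: (iffP idP) => [|[k uk wk]]; last exact: word_mx_cat_gt0 uk wk.
rewrite word_mx_catE => /sumr_gt0_ex[k|k uw].
  by rewrite mulr_ge0 ?word_mx_ge0.
exists k; rewrite lt_neqAle word_mx_ge0 andbT eq_sym; apply: contraTneq uw => ->.
  by rewrite mul0r ltxx.
by rewrite mulr0 ltxx.
Qed.

(** A positive entry of a product of nonnegative matrices dominates the weight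
of one path, a product of positive letter entries. *)
Lemma word_mx_entry_lb : exists2 c : R, 0 < c <= 1 &
  forall w i j, 0 < M w i j -> c ^+ size w <= M w i j.
Proof.
have [c c01 cH] : exists2 c : R, 0 < c <= 1 & forall t : S * (state * state),
    0 < H t.1 t.2.1 t.2.2 -> c <= H t.1 t.2.1 t.2.2.
  by apply: finite_min_pos => t.
exists c => //; elim=> [|a w IH] i j.
  rewrite word_mx_nil mxE expr0; case: (i == j) => //=.
  by rewrite ltxx.
rewrite -cat1s => aw; have /word_mx_cat_gt0P[k] := aw.
have -> : M [:: a] = H a by rewrite word_mx_cons word_mx_nil mulmx1.
move=> ak wk; rewrite [size _]/= exprS word_mx_catE (bigD1 k)//.
have -> : M [:: a] = H a by rewrite word_mx_cons word_mx_nil mulmx1.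
rewrite -[leLHS]addr0 lerD//; last first.
  by rewrite sumr_ge0// => l _; rewrite mulr_ge0 ?word_mx_ge0 ?hmm_ge0.
have /andP[c0 _] := c01.
by apply: ler_pM; rewrite ?IH ?(cH (a, (i, k)))// ?exprn_ge0// ltW.
Qed.

(** The support of v *m M w for every nonnegative v of support T.  That it
depends on T only is what keeps the relevant state space finite. *)
Definition step (T : {set state}) (w : seq S) : {set state} :=
  [set j | [exists i in T, 0 < M w i j]].

Lemma step_nil T : step T [::] = T.
Proof.
apply/setP => j; rewrite inE; apply/existsP/idP => [[i /andP[iT]]|jT].
  by rewrite word_mx_nil mxE; case: eqP => [<-//|]; rewrite ltxx.
by exists j; rewrite jT word_mx_nil mxE eqxx ltr01.
Qed.

Lemma step_cat T u w : step T (u ++ w) = step (step T u) w.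
Proof.
apply/setP => j; rewrite !inE; apply/existsP/existsP.
  move=> [i /andP[iT /word_mx_cat_gt0P[k uk wk]]].
  by exists k; rewrite wk inE andbT; apply/existsP; exists i; rewrite iT.
move=> [k /andP[]]; rewrite inE => /existsP[i /andP[iT uk] wk].
by exists i; rewrite iT; apply/word_mx_cat_gt0P; exists k.
Qed.

(** The norm of 1_T *m M w, where 1_T is the indicator row of T: a stand-in,
up to constant factors, for all vectors of support T. *)
Definition set_mass (T : {set state}) (w : seq S) : R :=
  \sum_(q in T) row_mass w q.

Lemma set_mass_ge0 T w : 0 <= set_mass T w.
Proof. by rewrite sumr_ge0// => q _; rewrite row_mass_ge0. Qed.

Lemma set_mass_le T w : set_mass T w <= #|Q|%:R.
Proof.
apply: (@le_trans _ _ (\sum_(q in T) 1)).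
  by apply: ler_sum => q _; rewrite row_mass_le1.
by rewrite sumr_const ler_nat (leq_trans (max_card _))// card_ord.
Qed.

Lemma sum_words_set_mass n T :
  \sum_(w <- words S n) set_mass T w <= #|Q|%:R.
Proof.
rewrite exchange_big/=; under eq_bigr do rewrite sum_words_row_mass.
by rewrite sumr_const ler_nat (leq_trans (max_card _))// card_ord.
Qed.

Lemma sum_entry_row_mass (T : {set state}) w (v : state -> R) :
  (forall q, 0 <= v q) -> (forall q, q \notin T -> v q = 0) ->
  \sum_q v q * row_mass w q <= (\sum_q v q) * set_mass T w.
Proof.
move=> v0 vT; rewrite /set_mass mulr_sumr [leRHS]big_mkcond/=.
apply: ler_sum => q _; case: ifPn => [qT|/vT->]; last by rewrite mul0r.
rewrite ler_wpM2r ?row_mass_ge0// (bigD1 q)//= lerDl sumr_ge0//.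
Qed.

(** 1_T *m M u is at most its own norm times the indicator of its support. *)
Lemma set_mass_cat T u w :
  set_mass T (u ++ w) <= set_mass T u * set_mass (step T u) w.
Proof.
have -> : set_mass T (u ++ w) =
    \sum_q (\sum_(i in T) M u i q) * row_mass w q.
  rewrite /set_mass; under eq_bigr do rewrite row_mass_cat.
  rewrite exchange_big; apply: eq_bigr => q _; by rewrite -mulr_suml.
have -> : set_mass T u = \sum_q \sum_(i in T) M u i q.
  by rewrite /set_mass /row_mass exchange_big.
apply: sum_entry_row_mass => // q.
  by rewrite sumr_ge0// => i _; rewrite word_mx_ge0.
rewrite inE => /existsPn nq; apply: big1 => i iT; apply/eqP.
by have := nq i; rewrite iT/= -leNgt eq_le word_mx_ge0 andbT.
Qed.

(** A pair (q, T) moves to (q', step T w) when the word w leads the hidden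
chain from q to q'. *)
Definition succ_state (x : state * {set state}) (w : seq S) (q : state) :
  state * {set state} := (q, step x.2 w).

Lemma succ_state_cat x u w q q' : succ_state (succ_state x u q) w q' = succ_state x (u ++ w) q'.
Proof. by rewrite /succ_state step_cat. Qed.

Definition succ_closed (X : state * {set state} -> Prop) :=
  forall x w q, X x -> 0 < M w x.1 q -> X (succ_state x w q).

(** The moment of order s of the ratio set_mass T w / row_mass w q under the
law of the words of length n emitted from q, that is, a Hellinger integral. *)
Definition affinity (s : R) (n : nat) (x : state * {set state}) : R :=
  \sum_(w <- words S n) set_mass x.2 w `^ s * row_mass w x.1 `^ (1 - s).

(** The same moment with the final hidden state revealed, which is the form
that can be chained from one block of letters to the next. *)
Definition entry_affinity (s : R) (n : nat) (x : state * {set state}) : R :=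
  \sum_(w <- words S n) \sum_q set_mass x.2 w `^ s * M w x.1 q `^ (1 - s).

Lemma affinity_le (s : R) n x : 0 < s < 1 -> affinity s n x <= #|Q|%:R + 1.
Proof.
move=> s01.
apply: (@le_trans _ _ (\sum_(w <- words S n) set_mass x.2 w +
                       \sum_(w <- words S n) row_mass w x.1)); last first.
  by rewrite sum_words_row_mass lerD2r sum_words_set_mass.
rewrite -big_split/=; apply: ler_sum => w _.
by rewrite powR_interpolate_le ?set_mass_ge0 ?row_mass_ge0.
Qed.

(** Both factors split at the block boundary: the first by set_mass_cat, the
second because t ^ (1 - s) is subadditive in t. *)
Lemma affinity_add (s : R) m n x : 0 < s < 1 ->
  affinity s (m + n) x <= \sum_(w <- words S m) \sum_q
    set_mass x.2 w `^ s * M w x.1 q `^ (1 - s) * affinity s n (succ_state x w q).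
Proof.
move=> /andP[s0 s1]; rewrite /affinity sum_words_cat; apply: ler_sum => u _.
under [leRHS]eq_bigr do rewrite mulr_sumr.
rewrite [leRHS]exchange_big; apply: ler_sum => w _ /=.
have st : set_mass x.2 (u ++ w) `^ s <=
    set_mass x.2 u `^ s * set_mass (step x.2 u) w `^ s.
  rewrite -powRM ?set_mass_ge0//.
  rewrite ge0_ler_powR ?nnegrE ?mulr_ge0 ?set_mass_ge0 ?set_mass_cat//.
  exact: ltW.
have rt : row_mass (u ++ w) x.1 `^ (1 - s) <=
    \sum_q M u x.1 q `^ (1 - s) * row_mass w q `^ (1 - s).
  rewrite row_mass_cat; under [leRHS]eq_bigr do rewrite -powRM ?word_mx_ge0 ?row_mass_ge0//.
  apply: powR_sum_le => [|q]; first by rewrite subr_gt0 s1; lra.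
  by rewrite mulr_ge0 ?word_mx_ge0 ?row_mass_ge0.
apply: le_trans (ler_pM _ _ st rt) _; rewrite ?powR_ge0//.
by rewrite mulr_sumr; apply: ler_sum => q _; rewrite mulrACA.
Qed.

Lemma affinity_decay (X : state * {set state} -> Prop) (s : R) m rho :
  0 < s < 1 -> 0 <= rho -> succ_closed X ->
  (forall x, X x -> entry_affinity s m x <= rho) ->
  forall n x, X x -> affinity s n x <= rho ^+ (n %/ m) * (#|Q|%:R + 1).
Proof.
move=> s01 rho0 Xcl Xrho; apply: block_decay => // [n x _|n beta nb x Xx].
  exact: affinity_le.
apply: le_trans (affinity_add m n x s01) _.
have beta0 : 0 <= beta.
  apply: le_trans (nb x Xx); apply: sumr_ge0 => w _.
  by rewrite mulr_ge0 ?powR_ge0.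
apply: le_trans (ler_wpM2r beta0 (Xrho x Xx)); rewrite /entry_affinity.
rewrite mulr_suml; apply: ler_sum => w _; rewrite mulr_suml; apply: ler_sum => q _.
have [->|Mq] := eqVneq (M w x.1 q) 0.
  rewrite powR0 ?mulr0 ?mul0r//; lra.
rewrite ler_wpM2l ?mulr_ge0 ?powR_ge0//; apply/nb/Xcl => //.
by rewrite lt_neqAle eq_sym Mq word_mx_ge0.
Qed.

(** Used for sets B whose complement is closed under successors: then being in
B after n letters means never having left B. *)
Definition stay_prob (B : pred (state * {set state})) (n : nat) x : R :=
  \sum_(w <- words S n) \sum_(q | B (succ_state x w q)) M w x.1 q.

Lemma stay_prob_le1 B n x : stay_prob B n x <= 1.
Proof.
rewrite -(sum_words_row_mass n x.1); apply: ler_sum => w _.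
by rewrite /row_mass big_mkcond; apply: ler_sum => q _; case: ifP; rewrite ?word_mx_ge0.
Qed.

Lemma stay_prob_ge0 B n x : 0 <= stay_prob B n x.
Proof. by do 2![apply: sumr_ge0 => ? _]; rewrite word_mx_ge0. Qed.

Lemma stay_prob_lt1 B n x w q : size w = n -> 0 < M w x.1 q ->
  ~~ B (succ_state x w q) -> stay_prob B n x < 1.
Proof.
move=> wn Mq nB; rewrite -(sum_words_row_mass n x.1) -subr_gt0 -sumrB.
have F0 v : 0 <= row_mass v x.1 - \sum_(q | B (succ_state x v q)) M v x.1 q.
  rewrite subr_ge0 /row_mass big_mkcond; apply: ler_sum => r _.
  by case: ifP; rewrite ?word_mx_ge0.
have Fw : 0 < row_mass w x.1 - \sum_(q | B (succ_state x w q)) M w x.1 q.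
  rewrite subr_gt0 /row_mass [ltRHS](bigID (fun q => B (succ_state x w q)))/=.
  rewrite ltrDl (bigD1 q)//= ltr_pwDl// sumr_ge0// => r _.
  by rewrite word_mx_ge0.
have : w \in words S n by rewrite mem_words wn.
move: (words S n) => s; elim: s => // v s IH; rewrite inE big_cons.
move=> /orP[/eqP<-|/IH]; first by rewrite ltr_pwDl// sumr_ge0.
by apply: ltr_wpDl.
Qed.

Lemma stay_prob_add (B : pred (state * {set state})) m n x :
  succ_closed (fun y => ~~ B y) ->
  stay_prob B (m + n) x =
  \sum_(w <- words S m) \sum_(q | B (succ_state x w q))
     M w x.1 q * stay_prob B n (succ_state x w q).
Proof.
move=> Bcl; rewrite /stay_prob sum_words_cat; apply: eq_bigr => u _.
under [RHS]eq_bigr do rewrite mulr_sumr.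
rewrite exchange_big; apply: eq_bigr => w _ /=.
under eq_bigr do rewrite word_mx_catE.
rewrite exchange_big/= [RHS]big_mkcond/=; apply: eq_bigr => k _.
case: ifPn => [Bk|nBk].
  by rewrite mulr_sumr; apply: eq_bigl => q; rewrite succ_state_cat.
apply: big1 => q Bq; have [->|Mk] := eqVneq (M w k q) 0; first by rewrite mulr0.
have Mk0 : 0 < M w k q by rewrite lt_neqAle eq_sym Mk word_mx_ge0.
by have := Bcl (succ_state x u k) w q nBk Mk0; rewrite succ_state_cat Bq.
Qed.

(** From every pair of B the probability to stay for n letters drops below 1
for some n; as B is finite, one n and one bound below 1 serve all pairs. *)
Lemma stay_prob_decay (B : pred (state * {set state})) :
  succ_closed (fun y => ~~ B y) ->
  (forall x, B x -> exists w q, 0 < M w x.1 q /\ ~~ B (succ_state x w q)) ->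
  exists m (rho : R), [/\ (0 < m)%N, 0 <= rho < 1 &
    forall n x, B x -> stay_prob B n x <= rho ^+ (n %/ m)].
Proof.
move=> Bcl Bexit.
have mono n p x : stay_prob B (n + p) x <= stay_prob B n x.
  rewrite stay_prob_add//; apply: ler_sum => w _; apply: ler_sum => q _.
  by rewrite -[leRHS]mulr1 ler_wpM2l ?word_mx_ge0 ?stay_prob_le1.
have /choice[N Nlt] : forall x, exists n, B x -> stay_prob B n x < 1.
  move=> x; have [Bx|_] := boolP (B x); last by exists 0%N.
  have [w [q [Mq nB]]] := Bexit x Bx.
  by exists (size w) => _; apply: stay_prob_lt1 Mq nB.
have [m0 mN] := finite_bound N; pose m := m0.+1.
have mlt x : B x -> 0 < 1 - stay_prob B m x.
  move=> Bx; rewrite subr_gt0; apply: le_lt_trans (Nlt x Bx).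
  by rewrite /m -(subnKC (leqW (mN x))) mono.
have [c c01 cB] := finite_min_pos mlt.
exists m, (1 - c); split => // [|n x Bx]; first by lra.
rewrite -[leRHS]mulr1; move: n x Bx; apply: (@block_decay _ _ B); first by lra.
  by move=> n x _; apply: stay_prob_le1.
move=> n beta nb x Bx; rewrite stay_prob_add//.
have beta0 : 0 <= beta by apply: le_trans (nb x Bx); rewrite stay_prob_ge0.
apply: (@le_trans _ _ (stay_prob B m x * beta)); last first.
  by rewrite ler_wpM2r//; have := cB x Bx; lra.
rewrite mulr_suml; apply: ler_sum => w _; rewrite mulr_suml; apply: ler_sum => q Bq.
by rewrite ler_wpM2l ?word_mx_ge0 ?nb.
Qed.

End Matrices.

(** * Probabilities of words *)

Section Masses.
Context (R : realType) (Q S : finType) (H : hmm R Q S).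
Local Notation M := (word_mx H).
Local Notation row_mass := (row_mass H).
Local Notation set_mass := (set_mass H).
Local Notation step := (step H).
Local Notation state := ('I_#|Q|).
Implicit Types (mu : init_dist R Q) (u w : seq S).

(** The norm of mu *m M w, the probability that w is emitted from mu. *)
Definition mass mu (w : seq S) : R := \sum_q mu ord0 q * row_mass w q.

(** The probability from mu to emit u and be in state q afterwards. *)
Definition mass_at mu u (q : state) : R := \sum_j mu ord0 j * M u j q.

Lemma dist_ge0 mu j : 0 <= mu ord0 j.
Proof. by have /andP[] := dist_unit mu j. Qed.

Lemma dist_sum mu : \sum_j mu ord0 j = 1.
Proof.
by rewrite -(dist_norm1 mu); apply: eq_bigr => j _; rewrite ger0_norm ?dist_ge0.
Qed.

Lemma mass_at_ge0 mu u q : 0 <= mass_at mu u q.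
Proof. by rewrite sumr_ge0// => j _; rewrite mulr_ge0 ?dist_ge0 ?word_mx_ge0. Qed.

Lemma mass_cat mu u w :
  mass mu (u ++ w) = \sum_q mass_at mu u q * row_mass w q.
Proof.
rewrite /mass; under eq_bigr do rewrite row_mass_cat mulr_sumr.
rewrite exchange_big; apply: eq_bigr => q _; rewrite mulr_suml.
by apply: eq_bigr => j _; rewrite mulrA.
Qed.

Lemma massE mu u : mass mu u = \sum_q mass_at mu u q.
Proof.
rewrite -[u in LHS]cats0 mass_cat; apply: eq_bigr => q _.
by rewrite row_mass_nil mulr1.
Qed.

Lemma mass_ge0 mu u : 0 <= mass mu u.
Proof. by rewrite massE sumr_ge0// => q _; rewrite mass_at_ge0. Qed.

Lemma mass_at_le mu u q : mass_at mu u q <= mass mu u.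
Proof.
by rewrite massE (bigD1 q)//= lerDl sumr_ge0// => k _; rewrite mass_at_ge0.
Qed.

Lemma mass_at_row_mass_le mu u w q :
  mass_at mu u q * row_mass w q <= mass mu (u ++ w).
Proof.
rewrite mass_cat (bigD1 q)//= lerDl sumr_ge0// => k _.
by rewrite mulr_ge0 ?mass_at_ge0 ?row_mass_ge0.
Qed.

Lemma sum_mass_cat mu u n : \sum_(w <- words S n) mass mu (u ++ w) = mass mu u.
Proof.
under eq_bigr do rewrite mass_cat.
rewrite exchange_big massE; apply: eq_bigr => q _ /=.
by rewrite -mulr_sumr sum_words_row_mass mulr1.
Qed.

Lemma mass_nil mu : mass mu [::] = 1.
Proof.
by rewrite -(dist_sum mu); apply: eq_bigr => q _; rewrite row_mass_nil mulr1.
Qed.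

Lemma sum_mass mu n : \sum_(w <- words S n) mass mu w = 1.
Proof. by rewrite -(mass_nil mu) -(sum_mass_cat mu [::] n). Qed.

Lemma mass_cat_le1 mu u w : mass mu (u ++ w) <= mass mu u.
Proof.
rewrite mass_cat massE; apply: ler_sum => q _.
by rewrite ler_piMr ?mass_at_ge0 ?row_mass_le1.
Qed.

Lemma mass_le1 mu w : mass mu w <= 1.
Proof. by rewrite -(mass_nil mu) (mass_cat_le1 mu [::] w). Qed.

Definition init_support mu : {set state} := [set j | 0 < mu ord0 j].

Lemma mass_at_gt0 mu u q : (0 < mass_at mu u q) = (q \in step (init_support mu) u).
Proof.
rewrite inE; apply/idP/existsP => [/sumr_gt0_ex[j|j]|[j /andP[]]].
- by rewrite mulr_ge0 ?dist_ge0 ?word_mx_ge0.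
- move=> p0; exists j; rewrite inE !lt_neqAle dist_ge0 word_mx_ge0 !andbT !(eq_sym 0).
  by rewrite -negb_or -mulf_eq0 gt_eqF.
rewrite inE => j0 Mj; rewrite /mass_at (bigD1 j)//= ltr_wpDr ?mulr_gt0//.
by rewrite sumr_ge0// => k _; rewrite mulr_ge0 ?dist_ge0 ?word_mx_ge0.
Qed.

(** Together with mass_cat_ge: once u has been emitted, the vector is
comparable with the indicator row of its support. *)
Lemma mass_cat_le mu u w :
  mass mu (u ++ w) <= mass mu u * set_mass (step (init_support mu) u) w.
Proof.
rewrite mass_cat massE; apply: sum_entry_row_mass => q; first exact: mass_at_ge0.
by rewrite -mass_at_gt0 -leNgt => le0; apply/eqP; rewrite eq_le le0 mass_at_ge0.
Qed.

Lemma mass_cat_ge mu u : exists2 c : R, 0 < c &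
  forall w, c * set_mass (step (init_support mu) u) w <= mass mu (u ++ w).
Proof.
have [|c /andP[c0 _] cq] := @finite_min_pos R _
  [pred q | q \in step (init_support mu) u] (mass_at mu u).
  by move=> q; rewrite inE mass_at_gt0.
exists c => // w; rewrite mass_cat /set_mass mulr_sumr.
rewrite [leRHS](bigID (fun q => q \in step (init_support mu) u))/=.
rewrite -[leLHS]addr0 lerD//.
  by apply: ler_sum => q qT; rewrite ler_wpM2r ?row_mass_ge0 ?cq.
by rewrite sumr_ge0// => q _; rewrite mulr_ge0 ?mass_at_ge0 ?row_mass_ge0.
Qed.

Lemma norm1_mass mu w : norm1 (mu *m M w) = mass mu w.
Proof.
rewrite massE; apply: eq_bigr => j _; rewrite mxE ger0_norm//.
exact: mass_at_ge0.
Qed.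

End Masses.

(** * Probabilities as real numbers *)

Section Probability.
Context d (T : measurableType d) (R : realType) (P : probability T R).

Definition pr (A : set T) : R := fine (P A).

Lemma prE A : measurable A -> P A = (pr A)%:E.
Proof. by move=> mA; rewrite /pr fineK// fin_num_measure. Qed.

Lemma pr_ge0 A : 0 <= pr A.
Proof. by rewrite fine_ge0. Qed.

Lemma pr0 : pr set0 = 0.
Proof. by rewrite /pr measure0. Qed.

Lemma pr_le A B : measurable A -> measurable B -> A `<=` B -> pr A <= pr B.
Proof.
by move=> mA mB AB; rewrite -lee_fin -!prE//; apply: le_measure; rewrite ?inE.
Qed.

Lemma pr_split A B : measurable A -> measurable B ->
  pr A = pr (A `&` B) + pr (A `\` B).
Proof.
move=> mA mB; apply: EFin_inj; rewrite EFinD -!prE//.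
- by rewrite addeC; apply: measureDI.
- exact: measurableD.
- exact: measurableI.
Qed.

Lemma pr_le_setD A B : measurable A -> measurable B ->
  pr A <= pr B + pr (A `\` B).
Proof.
move=> mA mB; rewrite (pr_split mA mB) lerD2r pr_le//.
exact: measurableI.
Qed.

Lemma pr_partition (I : eqType) (f : T -> I) (s : seq I) A :
  uniq s -> (forall i, measurable [set x | f x = i]) -> measurable A ->
  (forall x, A x -> f x \in s) ->
  pr A = \sum_(i <- s) pr (A `&` [set x | f x = i]).
Proof.
move=> + mf; elim: s A => [|i s IH] A /=.
  move=> _ _ As; rewrite big_nil (_ : A = set0) ?pr0//.
  by apply/seteqP; split=> // x /As.
move=> /andP[ins us] mA As; rewrite big_cons (pr_split mA (mf i)); congr (_ + _).
rewrite IH//; last 2 first.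
- exact: measurableD.
- by move=> x [/As]; rewrite inE => /orP[/eqP|].
apply: eq_big_seq => j js; congr (pr _).
apply/seteqP; split=> x /= [].
  by move=> [Ax _] fj.
by move=> Ax fj; split=> //; split=> // fi; rewrite -fi fj js in ins.
Qed.

Lemma pr_partition_fin (I : finType) (f : T -> I) A :
  (forall i, measurable [set x | f x = i]) -> measurable A ->
  pr A = \sum_i pr (A `&` [set x | f x = i]).
Proof.
move=> mf mA; rewrite (pr_partition (enum_uniq I) mf mA) ?big_enum// => x _.
by rewrite mem_enum.
Qed.

Lemma pr_bigcup0 (F : nat -> set T) :
  (forall n, measurable (F n)) -> (forall n, pr (F n) = 0) ->
  pr (\bigcup_n F n) = 0.
Proof.
move=> mF F0; apply: EFin_inj; rewrite -prE; last exact: bigcupT_measurable.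
apply/negligibleP; first exact: bigcupT_measurable.
apply: negligible_bigcup => n; apply/negligibleP => //.
by have := prE (mF n); rewrite F0.
Qed.

(** Continuity from above, in the form needed for estimates. *)
Lemma pr_vanishing (F : nat -> set T) :
  (forall n, measurable (F n)) -> (forall n m, (n <= m)%N -> F m `<=` F n) ->
  \bigcap_n F n = set0 ->
  forall eps : R, 0 < eps -> exists N, forall n, (N <= n)%N -> pr (F n) <= eps.
Proof.
move=> mF niF F0 eps eps0.
have : P \o F @ \oo --> P (\bigcap_n F n).
  apply: nonincreasing_cvg_mu => //.
  - by rewrite ltey_eq fin_num_measure.
  - by rewrite F0.
  - by move=> n m nm; apply/subsetPset/niF.
rewrite F0 measure0 => /fine_cvgP[_] /cvgrPdist_le/(_ eps eps0)[N _ HN].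
exists N => n Nn; have := HN n Nn; rewrite /= sub0r normrN ger0_norm//.
exact: pr_ge0.
Qed.

End Probability.

(** * The Markov property of the measure on runs *)

Section Runs.
Context (R : realType) (Q S : finType) (H : hmm R Q S) (pi : init_dist R Q).
Context (P : probability (run_space H pi) R) (hP : is_run_measure P).
Local Notation M := (word_mx H).
Local Notation state := ('I_#|Q|).
Local Notation run := (run_space H pi).
Local Notation pr := (pr P).

Definition visited (r : run) (n : nat) : state := enum_rank (r.1 n).

Definition segment (r : run) (k n : nat) : seq S := [seq r.2 i | i <- iota k n].

Lemma size_segment r k n : size (segment r k n) = n.
Proof. by rewrite size_map size_iota. Qed.

Lemma segment_cat r k m n :
  segment r k (m + n) = segment r k m ++ segment r (k + m) n.
Proof. by rewrite /segment iotaD map_cat. Qed.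

Lemma take_segment r m n : (m <= n)%N -> take m (segment r 0 n) = segment r 0 m.
Proof.
by move=> mn; rewrite -(subnKC mn) segment_cat take_size_cat ?size_segment.
Qed.

Definition transitions (r : run) (n : nat) : seq (S * state) :=
  mkseq (fun i => (r.2 i, visited r i.+1)) n.

Lemma transitionsS r n :
  transitions r n.+1 = rcons (transitions r n) (r.2 n, visited r n.+1).
Proof. by rewrite /transitions mkseqS. Qed.

Lemma transitions_letters r n : map fst (transitions r n) = segment r 0 n.
Proof. by rewrite /transitions /mkseq -map_comp. Qed.

Lemma transitions_last r n : last (visited r 0) (map snd (transitions r n)) = visited r n.
Proof. by case: n => // n; rewrite transitionsS map_rcons last_rcons. Qed.

(** The cylinder of the runs that start in j and then follow the pairs
(letter, next state) listed in s; lists make one-step extensions a rcons. *)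
Definition path_set (j : state) (s : seq (S * state)) : set run :=
  [set r | visited r 0 = j /\ transitions r (size s) = s].

Definition path_end (j : state) (s : seq (S * state)) : state := last j (map snd s).

Lemma path_end_rcons j s t : path_end j (rcons s t) = t.2.
Proof. by rewrite /path_end map_rcons last_rcons. Qed.

Lemma path_set_visited j s r : path_set j s r -> visited r (size s) = path_end j s.
Proof. by move=> [r0 rs]; rewrite -transitions_last rs r0. Qed.

Lemma path_set_segment j s r : path_set j s r -> segment r 0 (size s) = map fst s.
Proof. by move=> [r0 rs]; rewrite -transitions_letters rs. Qed.

Lemma path_set_rcons j s t :
  path_set j (rcons s t) =
  path_set j s `&` [set r | (r.2 (size s), visited r (size s).+1) = t].
Proof.
apply/seteqP; split=> r; rewrite /path_set /= size_rcons transitionsS.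
  by move=> [r0 /eqP]; rewrite eqseq_rcons => /andP[/eqP ? /eqP ?].
by move=> [[r0 ->] <-].
Qed.

Definition letter0 : S := xchoose (letter_inhabited H pi).

Lemma path_set_cylinder j s :
  path_set j s = cylinder (size s)
    (fun i => enum_val (nth j (j :: map snd s) i)) (nth letter0 (map fst s)).
Proof.
apply/seteqP; split=> r.
  move=> /[dup] rs [r0 rt]; split=> i.
    case: i => [_|i is_] /=; first by rewrite -r0 enum_rankK.
    by rewrite -rt /transitions /mkseq -map_comp (nth_map 0%N) ?size_iota//
       nth_iota//= enum_rankK.
  by move=> is_; rewrite -(path_set_segment rs) (nth_map 0%N) ?size_iota// nth_iota.
move=> [rq ra]; split; first by rewrite /visited rq// enum_valK.
apply: (@eq_from_nth _ (letter0, j)); first by rewrite size_mkseq.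
move=> i; rewrite size_mkseq => is_; rewrite nth_mkseq// ra// /visited rq//= enum_valK.
by rewrite !(nth_map (letter0, j))//; case: (nth _ s i).
Qed.

Lemma measurable_path_set j s : measurable (path_set j s).
Proof.
apply: sub_gen_smallest; rewrite path_set_cylinder.
by exists (size s); do 2!eexists.
Qed.

Lemma pr_path_set j s :
  pr (path_set j s) = pi ord0 j * \prod_(i < size s)
    H (nth letter0 (map fst s) i) (nth j (j :: map snd s) i) (nth j (map snd s) i).
Proof.
rewrite /pr path_set_cylinder hP /= !enum_valK; congr (_ * _).
by apply: eq_bigr => i _; rewrite !enum_valK.
Qed.

Lemma pr_path_set_rcons j s a k :
  pr (path_set j (rcons s (a, k))) = pr (path_set j s) * H a (path_end j s) k.
Proof.
rewrite !pr_path_set size_rcons big_ord_recr/= mulrA; congr (_ * _ * _).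
  apply: eq_bigr => i _; rewrite !map_rcons -rcons_cons !nth_rcons/= !size_map ltn_ord.
  by rewrite (leq_trans (ltn_ord i)).
rewrite !map_rcons -rcons_cons !nth_rcons/= !size_map ltnn eqxx ltnS leqnn.
by rewrite /path_end -nth_last -(size_map snd s); congr (H _ _ _); case: (map _ s).
Qed.

(** There are countably many paths, and each has a measurable cylinder. *)
Lemma measurable_prefix_dependent (n : nat) (B : state -> seq (S * state) -> Prop) :
  measurable [set r : run | B (visited r 0) (transitions r n)].
Proof.
have -> : [set r : run | B (visited r 0) (transitions r n)] =
    \bigcup_(x in [set x : state * seq (S * state) | B x.1 x.2 /\ size x.2 = n])
       path_set x.1 x.2.
  apply/seteqP; split=> r /=.
    move=> Br; exists (visited r 0, transitions r n) => /=.
      by rewrite size_mkseq.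
    by rewrite /path_set /= size_mkseq.
  by move=> [[j s] /= [Bjs <-] [-> ->]].
rewrite bigcup_mkcond; apply: countable_bigcupT_measurable => [|x].
  exact: countableP.
by case: ifP => _; [exact: measurable_path_set|exact: measurable0].
Qed.

Lemma measurable_segment k n (B : seq S -> Prop) :
  measurable [set r : run | B (segment r k n)].
Proof.
rewrite (_ : [set r | _] =
    [set r | B (drop k (map fst (transitions r (k + n))))]).
  exact: (measurable_prefix_dependent (k + n) (fun _ s => B (drop k (map fst s)))).
apply/seteqP; split=> r /=; rewrite transitions_letters segment_cat.
  by rewrite drop_size_cat ?size_segment.
by rewrite drop_size_cat ?size_segment.
Qed.

Lemma measurable_visited n q : measurable [set r : run | visited r n = q].
Proof.
rewrite (_ : [set r | _] =
    [set r | last (visited r 0) (map snd (transitions r n)) = q]).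
  exact: (measurable_prefix_dependent n (fun j s => last j (map snd s) = q)).
by apply/seteqP; split=> r /=; rewrite transitions_last.
Qed.

Lemma pr_path_set_step j s A : measurable A ->
  pr (path_set j s `&` A) =
  \sum_a \sum_k pr (path_set j (rcons s (a, k)) `&` A).
Proof.
move=> mA; pose f (r : run) := (r.2 (size s), visited r (size s).+1).
have mf t : measurable [set r | f r = t].
  rewrite (_ : [set r | _] =
    [set r | last t (transitions r (size s).+1) = t]).
    exact: (measurable_prefix_dependent _ (fun _ s => last t s = t)).
  by apply/seteqP; split=> r; rewrite /mkset transitionsS last_rcons.
have mPA : measurable (path_set j s `&` A).
  by apply: measurableI => //; exact: measurable_path_set.
rewrite (pr_partition_fin P mf mPA) pair_bigA /=; apply: eq_bigr => -[a k] _ /=.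
by rewrite path_set_rcons setIAC.
Qed.

Definition future (k : nat) (w : seq S) (q : state) : set run :=
  [set r | segment r k (size w) = w /\ visited r (k + size w) = q].

Lemma measurable_future k w q : measurable (future k w q).
Proof.
apply: measurableI; last exact: measurable_visited.
exact: (measurable_segment k (size w) (fun v => v = w)).
Qed.

(** The Markov property: if A has conditional probability kappa given any
continuation of the path s that emits w and ends in q, then it has conditional
probability kappa given only that w is emitted and q is reached.  Induction on
w, splitting according to the first transition. *)
Lemma markov A q kappa j s w : measurable A ->
  (forall s', map fst s' = w -> path_end j (s ++ s') = q ->
     pr (path_set j (s ++ s') `&` A) = pr (path_set j (s ++ s')) * kappa) ->
  pr (path_set j s `&` (future (size s) w q `&` A)) =
  pr (path_set j s) * M w (path_end j s) q * kappa.
Proof.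
move=> mA; elim: w s => [|a w IH] s As.
  rewrite word_mx_nil mxE; case: eqP => [sq|/eqP sq]; last first.
    rewrite mulr0 mul0r (_ : _ `&` _ = set0) ?pr0//.
    apply/seteqP; split=> r //= [rs [[_ rq] _]]; move: sq.
    by rewrite -(path_set_visited rs) -rq addn0 eqxx.
  rewrite mulr1 -[s in RHS]cats0 -As ?cats0//.
  congr (pr _); apply/seteqP; split=> r /= [rs]; first by move=> [_ ?].
  by move=> Ar; split=> //; split=> //; split=> //; rewrite addn0 (path_set_visited rs).
rewrite pr_path_set_step; last by apply: measurableI => //; exact: measurable_future.
rewrite (bigD1 a)//= [X in _ + X]big1 ?addr0 => [|b ba]; last first.
  apply: big1 => k _; rewrite (_ : _ `&` _ = set0) ?pr0//.
  apply/seteqP; split=> r //= []; rewrite path_set_rcons => -[_ [rb _]].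
  by move=> [[[ra _] _] _]; rewrite -rb -ra eqxx in ba.
rewrite -cat1s word_mx_catE mulr_sumr mulr_suml; apply: eq_bigr => k _.
rewrite {1}word_mx_cons word_mx_nil mulmx1 mulrA -pr_path_set_rcons.
have := IH (rcons s (a, k)); rewrite path_end_rcons /= => <-; last first.
  move=> s' s'w; rewrite cat_rcons => s'q; apply: As => //.
  by rewrite /= s'w.
congr (pr _); apply/seteqP; split=> r /= [rs [[rw rq] Ar]]; split => //; split=> //.
  by split; rewrite ?size_rcons ?addSnnS//; case: rw.
move: rs; rewrite path_set_rcons => -[_ /= [ra _]]; move: rw rq.
rewrite size_rcons addSnnS => rw rq; split => //.
by rewrite /segment /= ra; congr (_ :: _).
Qed.

Lemma pr_path_future j s w q :
  pr (path_set j s `&` future (size s) w q) =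
  pr (path_set j s) * M w (path_end j s) q.
Proof.
rewrite -[RHS]mulr1 -(@markov setT)// => [|s' _ _]; first by rewrite setIT.
by rewrite setIT mulr1.
Qed.

Lemma pr_visited0 j : pr (path_set j [::]) = pi ord0 j.
Proof. by rewrite pr_path_set /= big_ord0 mulr1. Qed.

Lemma pr_sum_initial A : measurable A -> pr A = \sum_j pr (path_set j [::] `&` A).
Proof.
move=> mA; rewrite (pr_partition_fin P (measurable_visited 0) mA).
apply: eq_bigr => j _; congr (pr _).
by apply/seteqP; split=> r [] => [Ar ?|[? _] ?].
Qed.

Lemma pr_future A q kappa w : measurable A ->
  (forall j s, map fst s = w -> path_end j s = q ->
     pr (path_set j s `&` A) = pr (path_set j s) * kappa) ->
  pr (future 0 w q `&` A) = mass_at H pi w q * kappa.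
Proof.
move=> mA As; rewrite pr_sum_initial; last first.
  by apply: measurableI => //; exact: measurable_future.
rewrite mulr_suml; apply: eq_bigr => j _.
rewrite -pr_visited0 -(@markov A q kappa j [::])// => s' s'w s'q; exact: As.
Qed.

Lemma pr_future2 u q w q' :
  pr (future 0 u q `&` future (size u) w q') =
  mass_at H pi u q * M w q q'.
Proof.
apply: pr_future; first exact: measurable_future.
by move=> j s <- <-; rewrite size_map pr_path_future.
Qed.

Lemma pr_future1 w q : pr (future 0 w q) = mass_at H pi w q.
Proof.
rewrite -[RHS]mulr1 -(@pr_future setT) ?setIT// => j s _ _.
by rewrite setIT mulr1.
Qed.

Lemma uniq_words n : uniq (words S n).
Proof.
elim: n => //= n IH; apply: allpairs_uniq => //; first exact: enum_uniq.
by move=> [a u] [b v] _ _ /= [-> ->].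
Qed.

Lemma pr_sum_futures n k A : measurable A ->
  pr A = \sum_(w <- words S n) \sum_q pr (A `&` future k w q).
Proof.
move=> mA; rewrite (pr_partition P (uniq_words n) _ mA (f := fun r => segment r k n)).
- apply: eq_big_seq => w; rewrite mem_words => /eqP wn.
  rewrite (pr_partition_fin P (measurable_visited (k + n))).
    by apply: eq_bigr => q _; congr (pr _); rewrite /future wn setIA.
  by apply: measurableI => //; exact: (measurable_segment k n (fun v => v = w)).
- by move=> w; exact: (measurable_segment k n (fun v => v = w)).
- by move=> r _; rewrite mem_words size_segment.
Qed.

(** The law of the emitted prefix: the event is the disjoint union over the
words and the final states. *)
Lemma pr_segment n (B : pred (seq S)) :
  pr [set r | B (segment r 0 n)] = \sum_(w <- words S n | B w) mass H pi w.
Proof.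
rewrite (pr_sum_futures n 0); last first.
  exact: (measurable_segment 0 n (fun w => B w)).
rewrite [RHS]big_mkcond; apply: eq_big_seq => w; rewrite mem_words => /eqP wn.
case: ifPn => Bw; last first.
  apply: big1 => q _; rewrite (_ : _ `&` _ = set0) ?pr0//.
  by apply/seteqP; split=> r //= [+ [+ _]]; rewrite wn => + rw; rewrite rw (negbTE Bw).
under eq_bigr => q _.
  rewrite (_ : _ `&` _ = future 0 w q); last first.
    by apply/seteqP; split=> r /= [] // rw rq; do ?split=> //; rewrite -wn rw.
  rewrite pr_future1; over.
by rewrite massE.
Qed.

End Runs.

(** * Exponential rates *)

Section Exponentials.
Context (R : realType).

Lemma expR_eventually_ge (C x : R) : 0 < x ->
  exists N, forall m, (N <= m)%N -> C <= expR (x * m%:R).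
Proof.
move=> x0; exists (Num.trunc (`|C| / x)).+1 => m Nm.
apply: le_trans (expR_ge1Dx _); rewrite -lerBlDl.
have : `|C| / x <= m%:R.
  apply: ltW; apply: lt_le_trans (truncnS_gt _) _; by rewrite ler_nat.
rewrite ler_pdivrMr// mulrC; apply: le_trans; rewrite lerBlDr.
by rewrite ler_wpDr// ler_norm.
Qed.

(** Rounding n / p down costs a constant factor only. *)
Lemma expR_divn (x : R) n p : (0 < p)%N ->
  expR x ^+ (n %/ p) <= expR `|x| * expR (x * (n%:R / p%:R)).
Proof.
move=> p0; rewrite -expRM_natr -expRD ler_expR -lerBlDr -mulrBr.
apply: le_trans (ler_norm _) _; rewrite normrM ler_piMr//.
have pR : 0 < p%:R :> R by rewrite ltr0n.
have nE : n%:R = (n %/ p)%:R * p%:R + (n %% p)%:R :> R.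
  by rewrite -natrM -natrD -divn_eq.
rewrite nE mulrDl mulfK ?gt_eqF// opprD addrA subrr add0r normrN.
rewrite ger0_norm ?divr_ge0// ler_pdivrMr// mul1r ler_nat ltnW//.
by rewrite ltn_mod.
Qed.

Lemma powR_scale_le (s y a b : R) : 0 < s < 1 -> 0 <= y -> 0 < a -> 0 <= b ->
  y <= b * a -> y `^ s * a `^ (1 - s) <= b `^ s * a.
Proof.
move=> /andP[s0 s1] y0 a0 b0 yab.
apply: (@le_trans _ _ ((b * a) `^ s * a `^ (1 - s))).
  rewrite ler_wpM2r ?powR_ge0// ge0_ler_powR ?nnegrE ?(ltW s0)//.
  by rewrite mulr_ge0// ltW.
rewrite powRM ?(ltW a0)// -mulrA -powRD ?subrKC ?oner_eq0//.
by rewrite powRr1// ltW.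
Qed.

End Exponentials.

(** * Large deviations of the likelihood ratio *)

Section Deviations.
Context (R : realType) (Q S : finType) (H : hmm R Q S) (pi1 pi2 : init_dist R Q).
Context (P : probability (run_space H pi2) R) (hP : is_run_measure P).
Local Notation M := (word_mx H).
Local Notation state := ('I_#|Q|).
Local Notation run := (run_space H pi2).
Local Notation pr := (pr P).
Local Notation mass := (mass H).
Local Notation path_set := (@path_set R Q S H pi2).
Local Notation succ_state := (succ_state H).
Local Notation T0 := (init_support pi1).

Definition word_ratio (w : seq S) : R := mass pi1 w / mass pi2 w.

Lemma word_ratio_ge0 w : 0 <= word_ratio w.
Proof. by rewrite divr_ge0 ?mass_ge0. Qed.

Definition below (theta : R) (N : nat) : set run :=
  [set r | forall n, (N <= n)%N -> word_ratio (segment r 0 n) <= expR (theta * n%:R)].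

Definition eventually_below (theta : R) : set run := \bigcup_N below theta N.

Definition above (theta : R) (n : nat) : set run :=
  [set r | expR (theta * n%:R) < word_ratio (segment r 0 n)].

Lemma measurable_below theta N : measurable (below theta N).
Proof.
rewrite (_ : below theta N = \bigcap_n
    [set r | (N <= n)%N -> word_ratio (segment r 0 n) <= expR (theta * n%:R)]).
  apply: bigcapT_measurable => n.
  exact: (measurable_segment 0 n (fun w => (N <= n)%N -> word_ratio w <= expR (theta * n%:R))).
by apply/seteqP; split=> r rN n; [move=> _; exact: rN|exact: rN].
Qed.

Lemma measurable_eventually_below theta : measurable (eventually_below theta).
Proof. by apply: bigcupT_measurable => N; exact: measurable_below. Qed.

Lemma measurable_above theta n : measurable (above theta n).
Proof. exact: (measurable_segment 0 n (fun w => expR (theta * n%:R) < word_ratio w)). Qed.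

Definition path_state (j : state) (s : seq (S * state)) : state * {set state} :=
  (path_end j s, step H T0 (map fst s)).

Lemma path_state_rcons j s a k :
  path_state j (rcons s (a, k)) = succ_state (path_state j s) [:: a] k.
Proof. by rewrite /path_state path_end_rcons map_rcons /succ_state -cats1 step_cat. Qed.

(** The path may depend on eps: only its end pair matters for the future growth
rate of the ratio. *)
Definition pure (theta : R) (x : state * {set state}) : Prop :=
  forall eps : R, 0 < eps -> exists N j s, [/\ path_state j s = x,
    0 < pr (path_set j s) &
    pr (path_set j s `\` below theta N) <= eps * pr (path_set j s)].

Lemma word_mx1 a : M [:: a] = H a.
Proof. by rewrite word_mx_cons word_mx_nil mulmx1. Qed.

(** Extending a path by a transition of probability h costs a factor 1 / h in
the conditional probability, which a smaller eps pays for. *)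
Lemma pure_closed theta : succ_closed H (pure theta).
Proof.
move=> x w; elim: w x => [|a w IH] x q px.
  rewrite word_mx_nil mxE; case: eqP => [<- _|_]; last by rewrite ltxx.
  by rewrite /succ_state step_nil -surjective_pairing.
rewrite -cat1s => /word_mx_cat_gt0P[k ak wk]; rewrite -(succ_state_cat _ _ _ _ k).
apply: IH => // eps eps0; rewrite word_mx1 in ak.
have [N [j [s [sx s0 sN]]]] := px (eps * H a x.1 k) (mulr_gt0 eps0 ak).
have xs : x.1 = path_end j s by rewrite -sx.
exists N, j, (rcons s (a, k)); rewrite path_state_rcons sx.
rewrite (pr_path_set_rcons hP) -xs; split; rewrite ?mulr_gt0//.
rewrite [pr _ * _]mulrC mulrA; apply: le_trans sN.
have mN := measurable_below theta N.
apply: pr_le; [| |by apply: setSD => r; rewrite path_set_rcons => -[]];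
  by apply: measurableD => //; exact: measurable_path_set.
Qed.

Definition live theta (x : state * {set state}) : Prop :=
  exists w q, 0 < M w x.1 q /\ pure theta (succ_state x w q).

(** If no reachable pair is pure, one c > 0 bounds the conditional probability
to leave the event below from every path that continues s.  Hence a fraction at
least c of the runs that satisfy the bound up to time n violates it later; this
fraction vanishes as n grows, so the event below has probability 0 itself. *)
Lemma dead_path theta N j s : ~ live theta (path_state j s) ->
  pr (path_set j s `&` below theta N) = 0.
Proof.
set x := path_state j s => dead.
pose reach y := exists w q, 0 < M w x.1 q /\ y = succ_state x w q.
have mp t : measurable (path_set j t) := measurable_path_set j t.
have mb := measurable_below theta N.
have /choice[e e_gt0] : forall y, exists e : R, 0 < e /\
    (reach y -> forall t, path_state j t = y ->
       e * pr (path_set j t) <= pr (path_set j t `\` below theta N)).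
  move=> y; have [ry|] := pselect (reach y); last by exists 1.
  have : ~ pure theta y.
    by move=> py; apply: dead; case: ry py => w [q [Mq ->]] py; exists w, q.
  move=> /existsNP[e] /not_implyP[e0] ne; exists e; split=> // _ t ty.
  rewrite leNgt; apply/negP => lt_te; apply: ne; exists N, j, t; split => //.
    rewrite lt_neqAle pr_ge0 andbT eq_sym; apply/eqP => t0.
    by move: lt_te; rewrite t0 mulr0 ltNge pr_ge0.
  exact: ltW.
(* The pairs are finitely many, so the constants e y have a common lower bound. *)
have [c /andP[c0 _] ce] := @finite_min_pos R _ predT e (fun y _ => (e_gt0 y).1).
pose upto n : set run := [set r | forall m, (N <= m <= n)%N ->
  word_ratio (take m (segment r 0 n)) <= expR (theta * m%:R)].
have mu n : measurable (upto n).
  exact: (measurable_segment 0 n (fun w => forall m, (N <= m <= n)%N ->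
    word_ratio (take m w) <= expR (theta * m%:R))).
(* By induction on the number d of transitions between the end of t and the time
   up to which the bound is required; at d = 0 it concerns the letters of t only. *)
have key d t : reach (path_state j t) \/ pr (path_set j t) = 0 ->
    c * pr (path_set j t `&` upto (size t + d)%N) <=
    pr (path_set j t `&` (upto (size t + d)%N `\` below theta N)).
  elim: d t => [|d IH] t rt.
    have [ut|nut] := pselect (forall m, (N <= m <= size t)%N ->
        word_ratio (take m (map fst t)) <= expR (theta * m%:R)).
      have tu : path_set j t `<=` upto (size t + 0)%N.
        by move=> r rr; rewrite addn0 /upto /= (path_set_segment rr).
      rewrite setIDA (setIidl tu); case: rt => [rt|->]; last by rewrite mulr0 pr_ge0.
      apply: le_trans ((e_gt0 _).2 rt _ erefl).
      by rewrite ler_wpM2r ?pr_ge0// ce.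
    rewrite (_ : path_set j t `&` upto _ = set0) ?pr0 ?mulr0 ?pr_ge0//.
    apply/seteqP; split=> r //= [rr]; rewrite addn0 /upto /= (path_set_segment rr).
    exact: nut.
  rewrite (pr_path_set_step P j t (mu _)).
  rewrite (pr_path_set_step P j t (measurableD (mu _) mb)).
  rewrite mulr_sumr; apply: ler_sum => a _; rewrite mulr_sumr; apply: ler_sum => k _.
  have := IH (rcons t (a, k)); rewrite size_rcons addSnnS; apply.
  rewrite (pr_path_set_rcons hP) path_state_rcons.
  case: rt => [[w [q [Mq tq]]]|->]; last by right; rewrite mul0r.
  have [->|Hak] := eqVneq (H a (path_end j t) k) 0; first by right; rewrite mulr0.
  left; exists (w ++ [:: a]), k; rewrite tq succ_state_cat; split => //.
  apply: word_mx_cat_gt0 Mq _; rewrite word_mx1 lt_neqAle eq_sym hmm_ge0 andbT.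
  by move: Hak; rewrite -[path_end j t]/((path_state j t).1) tq.
have van := @pr_vanishing _ _ _ P (fun n => path_set j s `&` (upto (size s + n)%N `\` below theta N)).
apply/eqP; rewrite eq_le pr_ge0 andbT; apply/ler_addgt0Pl => eps eps0.
rewrite addr0 -(ler_pM2l c0).
have [n||||n Hn] := van _ _ _ (c * eps).
- by apply: measurableI => //; exact: measurableD.
- move=> n m nm r [rs [rm rb]]; split => //; split => // l /andP[Nl ln].
  have := rm l; rewrite Nl (leq_trans ln) ?leq_add2l// => /(_ isT).
  by rewrite !take_segment// (leq_trans ln)// leq_add2l.
- apply/seteqP; split=> r // rn; have [_ [_]] := rn 0%N I; apply => n Nn.
  have [_ [/(_ n) + _]] := rn n I; rewrite Nn leq_addl => /(_ isT).
  by rewrite take_segment// leq_addl.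
- by rewrite mulr_gt0.
apply: le_trans (Hn n (leqnn _)); apply: le_trans (key _ _ _); last first.
  left; exists [::], x.1; rewrite word_mx_nil mxE eqxx ltr01; split => //.
  by rewrite /succ_state step_nil.
rewrite ler_pM2l//; apply: pr_le; [exact: measurableI..|].
apply: setIS => r rb m /andP[Nm mn].
by rewrite take_segment// rb.
Qed.

Lemma path_set_future j s : path_set j s `<=` future 0 (map fst s) (path_end j s).
Proof.
move=> r rs; split; first by rewrite size_map (path_set_segment rs).
by rewrite size_map add0n (path_set_visited rs).
Qed.

(** Choose a path with conditional probability at least 1 - eps to satisfy the
bound.  Over the next m letters the ratio set_mass / M is at most
e^((theta' - d) m), except with probability 3 eps: the growth of the
likelihood ratio fails to be controlled with probability at most eps, and two
quotients of probabilities with bounded expectation exceed e^(d m) with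
probability at most eps each.  With exponent 1 / m, the first case contributes
at most e^(theta' - d), and the second 3 eps K, because the ratio never exceeds
K^m. *)
Lemma pure_entry_affinity theta theta' x : theta < theta' -> pure theta x ->
  exists N, forall m, (N <= m)%N ->
    entry_affinity H (m%:R^-1) m x <= expR theta'.
Proof.
move=> ltt px; have [c /andP[c0 c1] Mc] := word_mx_entry_lb H.
pose d := (theta' - theta) / 4; have d0 : 0 < d by rewrite divr_gt0 ?subr_gt0.
pose D : R := #|Q|%:R.
have D1 : 1 <= D by rewrite ler1n (leq_trans _ (ltn_ord x.1)).
pose K := D / c; have K1 : 1 <= K by rewrite ler_pdivlMr// mul1r (le_trans c1).
have K0 : 0 < K by apply: lt_le_trans K1.
pose g := expR (theta' - d).
have g_lt : g < expR theta' by rewrite ltr_expR ltrBlDr ltrDl.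
pose eps := (expR theta' - g) / (3 * K).
have eps0 : 0 < eps by apply: divr_gt0; [rewrite subr_gt0|rewrite mulr_gt0// ltr0n].
have [N0 [j [s [sx s0 sN]]]] := px eps eps0.
pose u := map fst s; pose k := size s.
have xT : x.2 = step H T0 u by rewrite -sx.
have xq : x.1 = path_end j s by rewrite -sx.
have uq0 : 0 < mass_at H pi2 u x.1.
  apply: lt_le_trans s0 _; rewrite -(pr_future1 hP) xq.
  apply: pr_le; [exact: measurable_path_set|exact: measurable_future|].
  exact: path_set_future.
have [c1' c1'0 Tc] := mass_cat_ge H pi1 u.
have [Na HNa] := expR_eventually_ge (D / eps) d0.
have [Nb HNb] := expR_eventually_ge (expR (theta * k%:R) / c1') d0.
exists (maxn 2 (maxn N0 (maxn Na Nb))) => m.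
rewrite !geq_max => /and4P[m2 mN0 mNa mNb].
have m_gt0 : 0 < m%:R :> R by rewrite ltr0n ltnW.
have sm01 : 0 < (m%:R^-1 : R) < 1.
  by rewrite invr_gt0 m_gt0 invf_lt1// ltr1n.
have /andP[sm0 sm1] := sm01.
(* Indicators of the three exceptional events on the block w: the likelihood ratio
   is too large, the second chain's probability of w exceeds by far that of w from
   x.1, or the latter exceeds by far the part of it that ends in q. *)
pose b1 w : R := if expR (theta * (k + m)%:R) < word_ratio (u ++ w) then 1 else 0.
pose b2 w : R := if expR (d * m%:R) * row_mass H w x.1 < mass pi2 (u ++ w) then 1 else 0.
pose b3 w q : R := if expR (d * m%:R) * M w x.1 q < row_mass H w x.1 then 1 else 0.
have b1_ge0 w : 0 <= b1 w by rewrite /b1; case: ifP.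
have b2_ge0 w : 0 <= b2 w by rewrite /b2; case: ifP.
have b3_ge0 w q : 0 <= b3 w q by rewrite /b3; case: ifP.
have term w q : size w = m ->
    set_mass H x.2 w `^ m%:R^-1 * M w x.1 q `^ (1 - m%:R^-1) <=
    (g + K * (b1 w + b2 w + b3 w q)) * M w x.1 q.
  move=> wm.
  have [->|a_neq0] := eqVneq (M w x.1 q) 0.
    by rewrite powR0 ?mulr0// gt_eqF// subr_gt0.
  have a0 : 0 < M w x.1 q by rewrite lt_neqAle eq_sym a_neq0 word_mx_ge0.
  have row0 : 0 < row_mass H w x.1 by apply: lt_le_trans (word_mx_le_row_mass H w x.1 q).
  (* The ratio over the block is at most D / c^m <= K^m. *)
  have allK : set_mass H x.2 w `^ m%:R^-1 * M w x.1 q `^ (1 - m%:R^-1) <= K * M w x.1 q.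
    have -> : K = (K ^+ m) `^ m%:R^-1.
      by rewrite -powR_mulrn ?ltW// -powRrM mulfV ?gt_eqF// powRr1// ltW.
    apply: powR_scale_le => //; first exact: set_mass_ge0.
      by rewrite exprn_ge0// ltW.
    apply: le_trans (set_mass_le H x.2 w) _.
    rewrite /K exprMn exprVn -mulrA -[leLHS]mulr1 ler_pM//.
    - by rewrite -[leLHS]expr1 ler_weXn2l// ltnW.
    - rewrite mulrC ler_pdivlMr ?exprn_gt0// mul1r -wm; exact: Mc.
  have bge0 : 0 <= b1 w + b2 w + b3 w q by rewrite !addr_ge0.
  have [b1w|b1w] := boolP (expR (theta * (k + m)%:R) < word_ratio (u ++ w)).
    apply: le_trans allK _; rewrite ler_pM2r// ler_wpDl ?expR_ge0// ler_peMr ?(ltW K0)//.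
    by rewrite {1}/b1 b1w -addrA lerDl addr_ge0.
  have [b2w|b2w] := boolP (expR (d * m%:R) * row_mass H w x.1 < mass pi2 (u ++ w)).
    apply: le_trans allK _; rewrite ler_pM2r// ler_wpDl ?expR_ge0// ler_peMr ?(ltW K0)//.
    by rewrite {1}/b2 b2w addrAC lerDr addr_ge0.
  have [b3w|b3w] := boolP (expR (d * m%:R) * M w x.1 q < row_mass H w x.1).
    apply: le_trans allK _; rewrite ler_pM2r// ler_wpDl ?expR_ge0// ler_peMr ?(ltW K0)//.
    by rewrite {1}/b3 b3w lerDr addr_ge0.
  apply: (@le_trans _ _ (g * M w x.1 q)); last first.
    by rewrite ler_pM2r// lerDl mulr_ge0// ltW.
  have -> : g = expR ((theta' - d) * m%:R) `^ m%:R^-1.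
    by rewrite -expRM mulfK ?gt_eqF.
  apply: powR_scale_le; rewrite ?set_mass_ge0 ?expR_ge0//.
  rewrite -!leNgt in b1w b2w b3w.
  have p20 : 0 < mass pi2 (u ++ w).
    by apply: lt_le_trans (mass_at_row_mass_le H pi2 u w x.1); rewrite mulr_gt0.
  move: b1w; rewrite ler_pdivrMr// => b1w.
  have := Tc w; rewrite -xT mulrC -ler_pdivlMr// => /le_trans; apply.
  rewrite ler_pdivrMr//; apply: le_trans b1w _.
  have -> : expR (theta * (k + m)%:R) = expR (theta * k%:R) * expR (theta * m%:R).
    by rewrite -expRD -mulrDr -natrD.
  have := HNb m mNb; rewrite ler_pdivrMr// => HB.
  have -> : theta' - d = theta + d + d + d by rewrite /d; field.
  rewrite !mulrDl !expRD.
  have e1 : 0 < expR (theta * m%:R) := expR_gt0 _.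
  have e2 : 0 < expR (d * m%:R) := expR_gt0 _.
  apply: (@le_trans _ _ (expR (d * m%:R) * c1' * expR (theta * m%:R) *
      (expR (d * m%:R) * (expR (d * m%:R) * M w x.1 q)))).
    apply: ler_pM; rewrite ?mulr_ge0 ?expR_ge0 ?(ltW p20)//.
      by rewrite ler_pM2r.
    by apply: le_trans b2w _; rewrite ler_pM2l.
  by rewrite le_eqVlt; apply/orP; left; apply/eqP; ring.
apply: (@le_trans _ _ (\sum_(w <- words S m) \sum_q
    (g + K * (b1 w + b2 w + b3 w q)) * M w x.1 q)).
  rewrite /entry_affinity big_seq [leRHS]big_seq; apply: ler_sum => w.
  rewrite mem_words => /eqP wm; apply: ler_sum => q _.
  exact: term.
have -> : \sum_(w <- words S m) \sum_q (g + K * (b1 w + b2 w + b3 w q)) * M w x.1 q =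
    g + K * (\sum_(w <- words S m) \sum_q b1 w * M w x.1 q +
             \sum_(w <- words S m) b2 w * row_mass H w x.1 +
             \sum_(w <- words S m) \sum_q b3 w q * M w x.1 q).
  have gE : g = \sum_(w <- words S m) g * row_mass H w x.1.
    by rewrite -mulr_sumr sum_words_row_mass mulr1.
  rewrite [in RHS]gE -!big_split /= mulr_sumr -big_split /=; apply: eq_bigr => w _.
  rewrite /row_mass !mulr_sumr -!big_split /= mulr_sumr -big_split /=.
  by apply: eq_bigr => q _; ring.
(* Beyond time N0 the runs of the first exceptional event violate the bound. *)
have s1 : \sum_(w <- words S m) \sum_q b1 w * M w x.1 q <= eps.
  rewrite -(ler_pM2r s0); apply: le_trans sN.
  have mC : measurable (path_set j s `\` below theta N0).
    by apply: measurableD; [exact: measurable_path_set|exact: measurable_below].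
  rewrite (pr_sum_futures P m k mC) mulr_suml big_seq [leRHS]big_seq.
  apply: ler_sum => w; rewrite mem_words => /eqP wm.
  rewrite mulr_suml; apply: ler_sum => q _; rewrite /b1.
  case: ifPn => [b1w|_]; last by rewrite mul0r mul0r pr_ge0.
  rewrite mul1r mulrC xq -(pr_path_future hP); apply: pr_le.
  - by apply: measurableI; [exact: measurable_path_set|exact: measurable_future].
  - by apply: measurableI => //; exact: measurable_future.
  move=> r [rs rw]; split=> //; split => // rb.
  have := rb (k + m)%N; rewrite (leq_trans mN0) ?leq_addl// => /(_ isT).
  rewrite segment_cat (path_set_segment rs) -wm.
  by case: rw => -> _; rewrite leNgt wm b1w.
(* Markov's inequality: the probabilities of the words u ++ w have sum at most 1. *)
have s2 : \sum_(w <- words S m) b2 w * row_mass H w x.1 <= eps.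
  apply: (@le_trans _ _ (expR (- (d * m%:R)))).
    rewrite -[leRHS]mulr1; apply: le_trans (ler_wpM2l (expR_ge0 _) (mass_le1 H pi2 u)).
    rewrite -(sum_mass_cat H pi2 u m) mulr_sumr; apply: ler_sum => w _; rewrite /b2.
    case: ifPn => [b2w|_]; last by rewrite mul0r mulr_ge0 ?expR_ge0 ?mass_ge0.
    by rewrite mul1r expRN mulrC ler_pdivlMr ?expR_gt0// mulrC ltW.
  rewrite expRN invf_ple ?posrE ?expR_gt0//; apply: le_trans (HNa m mNa).
  by rewrite ler_peMl// invr_ge0 ltW.
(* Markov's inequality again, the sum over the states q giving the factor D. *)
have s3 : \sum_(w <- words S m) \sum_q b3 w q * M w x.1 q <= eps.
  apply: (@le_trans _ _ (expR (- (d * m%:R)) * D)).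
    have -> : expR (- (d * m%:R)) * D =
        \sum_(w <- words S m) expR (- (d * m%:R)) * D * row_mass H w x.1.
      by rewrite -mulr_sumr sum_words_row_mass mulr1.
    apply: ler_sum => w _.
    apply: (@le_trans _ _ (\sum_(q : state) expR (- (d * m%:R)) * row_mass H w x.1)).
      apply: ler_sum => q _; rewrite /b3.
      case: ifPn => [b3w|_]; last by rewrite mul0r mulr_ge0 ?expR_ge0 ?row_mass_ge0.
      by rewrite mul1r expRN mulrC ler_pdivlMr ?expR_gt0// mulrC ltW.
    by rewrite sumr_const card_ord -[leLHS]mulr_natl mulrCA mulrA lexx.
  rewrite expRN mulrC ler_pdivrMr ?expR_gt0// mulrC -ler_pdivrMr//.
  exact: HNa.
have : K * (\sum_(w <- words S m) \sum_q b1 w * M w x.1 q +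
             \sum_(w <- words S m) b2 w * row_mass H w x.1 +
             \sum_(w <- words S m) \sum_q b3 w q * M w x.1 q) <= K * (eps + eps + eps).
  by rewrite ler_pM2l// !lerD.
have -> : K * (eps + eps + eps) = expR theta' - g by rewrite /eps; field; lra.
by rewrite -lerBrDl.
Qed.

(** Markov's inequality for the moment of order s of the likelihood ratio,
after the word u and the state q at its end have been fixed. *)
Lemma pr_above_future (s theta : R) u q m : 0 < s < 1 ->
  pr (above theta (size u + m) `&` future 0 u q) <=
  expR (- (s * theta * (size u + m)%:R)) * (mass pi1 u + mass_at H pi2 u q) *
  affinity H s m (q, step H T0 u).
Proof.
move=> /[dup] s01 /andP[s0 s1]; set n := (size u + m)%N.
have mA : measurable (above theta n `&` future 0 u q).
  by apply: measurableI; [exact: measurable_above|exact: measurable_future].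
rewrite (pr_sum_futures P m (size u) mA) /affinity mulr_sumr.
rewrite big_seq [leRHS]big_seq; apply: ler_sum => w; rewrite mem_words => /eqP wm.
have [b|nb] := boolP (expR (theta * n%:R) < word_ratio (u ++ w)); last first.
  rewrite big1 ?mulr_ge0 ?expR_ge0 ?addr_ge0 ?mass_ge0 ?mass_at_ge0 ?powR_ge0// => q' _.
  rewrite (_ : _ `&` _ = set0) ?pr0//; apply/seteqP; split=> r //= [[ra [ru _]] [rw _]].
  have rE : segment r 0 n = u ++ w by rewrite segment_cat ru add0n -wm rw.
  have /negP := nb; apply; rewrite -rE; exact: ra.
have p20 : 0 < mass pi2 (u ++ w).
  rewrite lt_neqAle mass_ge0 andbT; apply: contraTneq b => p20.
  by rewrite /word_ratio -p20 invr0 mulr0 -leNgt expR_ge0.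
set p := mass_at H pi2 u q * row_mass H w q.
have p0 : 0 <= p by rewrite mulr_ge0 ?mass_at_ge0 ?row_mass_ge0.
apply: (@le_trans _ _ p).
  rewrite /p /row_mass mulr_sumr; apply: ler_sum => q' _.
  rewrite -(pr_future2 hP); apply: pr_le.
  - by apply: measurableI => //; exact: measurable_future.
  - by apply: measurableI; exact: measurable_future.
  - by move=> r [[_ ru] rw].
have -> : p = p `^ s * p `^ (1 - s).
  by rewrite -powRD ?subrKC ?oner_eq0// powRr1.
have ps : p `^ s <= expR (- (s * theta * n%:R)) *
    (mass pi1 u `^ s * set_mass H (step H T0 u) w `^ s).
  have -> : - (s * theta * n%:R) = - (theta * n%:R) * s by ring.
  rewrite expRM -!powRM ?mulr_ge0 ?expR_ge0 ?mass_ge0 ?set_mass_ge0//.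
  apply: ge0_ler_powR; rewrite ?nnegrE ?p0 ?mulr_ge0 ?expR_ge0 ?mass_ge0 ?set_mass_ge0 ?(ltW s0)//.
  apply: le_trans (mass_at_row_mass_le H pi2 u w q) _.
  rewrite expRN mulrC ler_pdivlMr ?expR_gt0//.
  apply: le_trans (mass_cat_le H pi1 u w); move: b; rewrite ltr_pdivlMr// mulrC.
  exact: ltW.
apply: le_trans (ler_wpM2r (powR_ge0 _ _) ps) _.
rewrite /p powRM ?mass_at_ge0 ?row_mass_ge0//= -!mulrA ler_wpM2l ?expR_ge0//.
rewrite mulrA mulrACA ler_wpM2r ?mulr_ge0 ?powR_ge0//.
by rewrite powR_interpolate_le ?mass_ge0 ?mass_at_ge0.
Qed.

Lemma sum_mass_at_stay (B : pred (state * {set state})) k :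
  \sum_(u <- words S k) \sum_(q | B (q, step H T0 u)) mass_at H pi2 u q =
  \sum_j pi2 ord0 j * stay_prob H B k (j, T0).
Proof.
under [RHS]eq_bigr do rewrite mulr_sumr.
rewrite exchange_big; apply: eq_bigr => u _ /=.
under [RHS]eq_bigr do rewrite mulr_sumr.
by rewrite exchange_big.
Qed.

(** Split at time k = n / jj for a large constant jj.  If the pair at time k is
pure, the moment bound applies to the remaining n - k letters; if it reaches no
pure pair, the event has probability 0; any other pair is improbable at time k.
The constant jj is such that losing k letters does not spoil the rate. *)
Lemma eventually_below_deviation theta theta' : theta < theta' ->
  exists C lambda : R, [/\ 0 <= C, 0 < lambda &
    forall n, pr (eventually_below theta `&` above theta' n) <=
              C * expR (- (lambda * n%:R))].
Proof.
move=> ltt; pose th := (theta + theta') / 2.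
have [tth thh] : theta < th /\ th < theta' by rewrite /th; split; lra.
have /choice[N HN] : forall x, exists N, pure theta x -> forall m, (N <= m)%N ->
    entry_affinity H (m%:R^-1) m x <= expR th.
  move=> x; have [px|] := pselect (pure theta x); last by exists 0%N.
  by have [N HN] := pure_entry_affinity tth px; exists N.
have [m0 Hm0] := finite_bound N; pose m := (m0 + 2)%N.
have m_gt0 : 0 < m%:R :> R by rewrite ltr0n /m addn2.
pose s : R := m%:R^-1.
have s01 : 0 < s < 1 by rewrite invr_gt0 m_gt0 invf_lt1// ltr1n /m addn2.
have /andP[s0 _] := s01.
have aff n x : pure theta x -> affinity H s n x <= expR th ^+ (n %/ m) * (#|Q|%:R + 1).
  apply: (affinity_decay s01 (expR_ge0 _) (@pure_closed theta)) => y py.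
  by apply: HN => //; rewrite (leq_trans (Hm0 y))// leq_addr.
(* The undetermined pairs; they are left for good, as pure pairs have pure
   successors and pairs that reach no pure one have such successors only. *)
pose B : pred (state * {set state}) := fun x => `[< live theta x /\ ~ pure theta x >].
have Bcl : succ_closed H (fun y => ~~ B y).
  move=> x w q /asboolPn nB Mq; apply/asboolPn => -[lx npx]; apply: nB.
  split; last by move=> px; apply/npx/pure_closed.
  have [v [q' [Mv pv]]] := lx; exists (w ++ v), q'.
  by rewrite -(succ_state_cat _ _ _ _ q); split => //; exact: word_mx_cat_gt0 Mq Mv.
have [|mB [rhoB [mB0 /andP[rB0 rB1] stayB]]] := stay_prob_decay Bcl.
  move=> x /asboolP[[w [q [Mq pq]]] _]; exists w, q; split => //.
  by apply/asboolPn => -[_]; apply.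
have stayB' n x : stay_prob H B n x <= rhoB ^+ (n %/ mB).
  have [/stayB//|nBx] := boolP (B x).
  rewrite /stay_prob big1 ?exprn_ge0// => w _; apply: big1 => q Bq; apply/eqP.
  rewrite eq_le word_mx_ge0 andbT leNgt; apply/negP => Mq.
  by have := Bcl x w q nBx Mq; rewrite Bq.
pose D : R := #|Q|%:R + 1; have D0 : 0 <= D by rewrite addr_ge0.
have main k n : (k <= n)%N -> pr (eventually_below theta `&` above theta' n) <=
    rhoB ^+ (k %/ mB) +
    expR (- (s * theta' * n%:R)) * (expR th ^+ ((n - k) %/ m) * D) * D.
  move=> kn; set A := _ `&` _.
  have mE := measurable_eventually_below theta.
  have mA : measurable A by apply: measurableI => //; exact: measurable_above.
  set Z := expR (- (s * theta' * n%:R)) * (expR th ^+ ((n - k) %/ m) * D).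
  have Z0 : 0 <= Z by rewrite mulr_ge0 ?expR_ge0// mulr_ge0// exprn_ge0 ?expR_ge0.
  have term u q : size u = k -> pr (A `&` future 0 u q) <=
      (if B (q, step H T0 u) then mass_at H pi2 u q else 0) +
      Z * (mass pi1 u + mass_at H pi2 u q).
    move=> uk; have mf := measurable_future (pi := pi2) 0 u q.
    have rhs0 : 0 <= Z * (mass pi1 u + mass_at H pi2 u q).
      by rewrite mulr_ge0 ?addr_ge0 ?mass_ge0 ?mass_at_ge0.
    have [lx|nlx] := pselect (live theta (q, step H T0 u)); last first.
      apply: (@le_trans _ _ 0); last first.
        by apply: addr_ge0 => //; case: ifP; rewrite ?mass_at_ge0.
      apply: (@le_trans _ _ (pr (future 0 u q `&` eventually_below theta))).
        apply: pr_le; [exact: measurableI..|].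
        by move=> r [[? ?] ?]; split.
      rewrite (pr_future hP (q := q) (kappa := 0) mE) ?mulr0// => j t tu tq.
      rewrite mulr0 /eventually_below setI_bigcupr; apply: pr_bigcup0 => i.
        by apply: measurableI; [exact: measurable_path_set|exact: measurable_below].
      by apply: dead_path; rewrite /path_state tq tu.
    have [px|npx] := pselect (pure theta (q, step H T0 u)).
      apply: (@le_trans _ _ (Z * (mass pi1 u + mass_at H pi2 u q))); last first.
        by rewrite lerDr; case: ifP; rewrite ?mass_at_ge0.
      apply: (@le_trans _ _ (pr (above theta' n `&` future 0 u q))).
        apply: pr_le; [exact: measurableI| |by move=> r [[]]].
        by apply: measurableI => //; exact: measurable_above.
      have -> : n = (size u + (n - k))%N by rewrite uk subnKC.
      apply: le_trans (pr_above_future _ _ _ _ s01) _.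
      rewrite uk subnKC// /Z mulrAC ler_wpM2r ?addr_ge0 ?mass_ge0 ?mass_at_ge0//.
      by rewrite ler_wpM2l ?expR_ge0 ?aff.
    have -> : B (q, step H T0 u) by apply/asboolP.
    apply: (@le_trans _ _ (mass_at H pi2 u q)); last by rewrite lerDl.
    rewrite -(pr_future1 hP); apply: pr_le => //; first exact: measurableI.
  rewrite (pr_sum_futures P k 0 mA).
  apply: (@le_trans _ _ (\sum_(u <- words S k) \sum_q
     ((if B (q, step H T0 u) then mass_at H pi2 u q else 0) +
      Z * (mass pi1 u + mass_at H pi2 u q)))).
    rewrite big_seq [leRHS]big_seq; apply: ler_sum => u; rewrite mem_words => /eqP uk.
    by apply: ler_sum => q _; apply: term.
  under eq_bigr do rewrite big_split/= -big_mkcond/= -mulr_sumr big_split/=.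
  rewrite big_split/= sum_mass_at_stay lerD//.
    apply: (@le_trans _ _ (\sum_j pi2 ord0 j * rhoB ^+ (k %/ mB))).
      by apply: ler_sum => j _; rewrite ler_wpM2l ?dist_ge0 ?stayB'.
    by rewrite -mulr_suml dist_sum mul1r.
  rewrite -mulr_sumr ler_wpM2l// big_split/= /D lerD//.
    under eq_bigr do rewrite sumr_const card_ord.
    by rewrite sumrMnl sum_mass.
  under eq_bigr do rewrite -massE.
  by rewrite sum_mass.
(* Then |th| k <= (theta' - th) / 2 * n for k = n / jj. *)
pose jj := (Num.trunc (2 * `|th| / (theta' - th))).+1.
have jj_gt0 : 0 < jj%:R :> R by rewrite ltr0n.
have jj_ge : 2 * `|th| <= (theta' - th) * jj%:R.
  by rewrite [leRHS]mulrC -ler_pdivrMr ?subr_gt0//; apply/ltW/truncnS_gt.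
(* rhoB may be 0, hence the maximum with 1/2 before taking the logarithm. *)
pose t := - ln (Num.max rhoB 2^-1); pose p := (jj * mB)%N.
have max_gt0 : 0 < Num.max rhoB 2^-1 :> R by rewrite lt_max orbC invr_gt0 ltr0n.
have t0 : 0 < t.
  by rewrite oppr_gt0 ln_lt0// max_gt0 gt_max rB1 invf_lt1 ?ltr1n.
have p_gt0 : 0 < p%:R :> R by rewrite ltr0n muln_gt0 mB0.
pose l1 := t / p%:R; pose l2 := s * (theta' - th) / 2.
have l1_gt0 : 0 < l1 by rewrite divr_gt0.
have l2_gt0 : 0 < l2 by rewrite divr_gt0// mulr_gt0// subr_gt0.
exists (expR t + expR `|th| * D * D), (Num.min l1 l2); split => [||n].
- by rewrite addr_ge0 ?expR_ge0// !mulr_ge0// expR_ge0.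
- by rewrite lt_min l1_gt0.
apply: le_trans (main (n %/ jj)%N n (leq_div n jj)) _.
have weaken l : Num.min l1 l2 <= l ->
    expR (- (l * n%:R)) <= expR (- (Num.min l1 l2 * n%:R)).
  by move=> ll; rewrite ler_expR lerN2 ler_wpM2r.
rewrite mulrDl lerD//.
  rewrite -divnMA -/p; apply: (@le_trans _ _ (expR (- t) ^+ (n %/ p))).
    rewrite lerXn2r ?nnegrE ?expR_ge0// /t opprK lnK ?posrE// le_max lexx//.
  apply: le_trans (expR_divn _ _ _) _; first by rewrite -(ltr0n R).
  rewrite normrN gtr0_norm// ler_wpM2l ?expR_ge0//.
  apply: le_trans (weaken l1 _); last by rewrite ge_min lexx.
  by rewrite /l1 mulNr mulrAC mulrA.
have key : expR (- (s * theta' * n%:R)) * expR th ^+ ((n - n %/ jj) %/ m) <=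
    expR `|th| * expR (- (Num.min l1 l2 * n%:R)).
  apply: le_trans (ler_wpM2l (expR_ge0 _) (expR_divn _ _ _)) _; first by rewrite /m addn2.
  rewrite mulrCA ler_wpM2l ?expR_ge0// -expRD.
  apply: le_trans (weaken l2 _); last by rewrite ge_min lexx orbT.
  rewrite ler_expR natrB ?leq_div// -/s /l2.
  have kn : (n %/ jj)%:R * jj%:R <= n%:R :> R by rewrite -natrM ler_nat leq_trunc_div.
  set k : R := (n %/ jj)%:R in kn *.
  have k0 : 0 <= k by [].
  have thk : `|th| * k <= (theta' - th) / 2 * n%:R.
    have := ler_wpM2r k0 jj_ge; have := ler_wpM2l (_ : 0 <= theta' - th) kn.
    by rewrite subr_ge0 ltW// => /(_ isT); lra.
  have := ler_norm (- th); rewrite normrN => nth.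
  have thk' : - th * k <= (theta' - th) / 2 * n%:R.
    by apply: le_trans thk; rewrite ler_wpM2r.
  have := ler_wpM2l (ltW s0) thk'; lra.
have := ler_wpM2r (mulr_ge0 D0 D0) key; lra.
Qed.

End Deviations.

(** * Expectation of a first failure time *)

Section ExitTime.
Context (R : realType).

(** The first n at which C fails is the number of n for which C holds up to n. *)
Lemma first_failure_series (C : nat -> Prop) :
  ereal_inf [set n%:R%:E | n in [set n | ~ C n]] =
  (\sum_(n <oo) (if `[< forall k, (k <= n)%N -> C k >] then 1 else 0 : R)%:E)%E.
Proof.
pose u n : \bar R := (if `[< forall k, (k <= n)%N -> C k >] then 1 else 0)%:E.
rewrite -[RHS]/(\sum_(n <oo) u n)%E.
have u0 n : (0 <= u n)%E by rewrite /u; case: ifP; rewrite lee_fin.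
have ones m : (forall k, (k < m)%N -> C k) ->
    (\sum_(0 <= n < m) u n = m%:R%:E)%E.
  move=> Cm; rewrite big_mkord (eq_bigr (fun=> 1%:E)) => [|i _].
    by rewrite sumEFin sumr_const card_ord.
  by rewrite /u ifT//; apply/asboolP => k ki; apply/Cm/(leq_ltn_trans ki).
have [allC|/existsNP[n nC]] := pselect (forall k, C k).
  rewrite (_ : [set _ | n in _] = set0) ?ereal_inf0; last first.
    by apply/seteqP; split=> // x [n /(_ (allC n))].
  apply/esym/eq_infty => r.
  apply: le_trans (nneseries_lim_ge (Num.trunc `|r|).+1 (fun n _ _ => u0 n)).
  rewrite ones// lee_fin; apply: le_trans (ler_norm r) _.
  exact/ltW/truncnS_gt.
pose D n := `[< ~ C n >].
have exD : exists n, D n by exists n; exact/asboolP.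
pose m := ex_minn exD.
have [nCm mC] : ~ C m /\ forall k, (k < m)%N -> C k.
  rewrite /m; case: ex_minnP => k /asboolP nCk kmin; split=> // j jk.
  by apply: contrapT => nCj; have := kmin j (asboolT nCj); rewrite leqNgt jk.
rewrite (@nneseries_split _ u 0 m) => [|k _]; last exact: u0.
rewrite add0n ones// eseries0 ?adde0 => [|i mi _]; last first.
  by rewrite /u ifF//; apply/asboolPn => /(_ m mi).
apply/eqP; rewrite eq_le; apply/andP; split; first by apply: ereal_inf_lbound; exists m.
apply: le_ereal_inf_tmp => _ [k nCk <-]; rewrite lee_fin ler_nat leqNgt.
by apply/negP => /mC.
Qed.

Context d (T : measurableType d) (P : probability T R).

Lemma integral_first_failure (E : set T) (C : nat -> set T) :
  measurable E -> (forall n, measurable (C n)) ->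
  (\int[P]_(x in E) ereal_inf [set n%:R%:E | n in [set n | ~ C n x]] =
   \sum_(n <oo) (pr P (E `&` \bigcap_(k in [set k | (k <= n)%N]) C k))%:E)%E.
Proof.
move=> mE mC.
have mA n : measurable (\bigcap_(k in [set k | (k <= n)%N]) C k).
  by apply: bigcap_measurable => //; exists 0%N.
under eq_integral => x _.
  rewrite first_failure_series.
  under eq_eseriesr => n _.
    rewrite (_ : (if _ then _ else _) =
        \1_(\bigcap_(k in [set k | (k <= n)%N]) C k) x); last first.
      rewrite indicE; case: ifPn => [/asboolP Cx|/asboolPn Cx].
        by rewrite mem_set.
      by rewrite memNset.
    over.
  over.
rewrite integral_nneseries//; last first.
  by move=> n; apply/measurable_EFinP; exact: measurable_indic.
apply: eq_eseriesr => n _; rewrite integral_indic// setIC.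
by apply: prE; exact: measurableI.
Qed.

End ExitTime.

(** * Bounds on series *)

Section SeriesBounds.
Context (R : realType).

Lemma nneseries_ub (u : nat -> R) (B : R) : (forall n, 0 <= u n) ->
  (forall N, \sum_(i < N) u i <= B) -> (\sum_(n <oo) (u n)%:E <= B%:E)%E.
Proof.
move=> u0 uB; apply: lime_le.
  by apply: is_cvg_nneseries => n _ _; rewrite lee_fin.
by apply: nearW => N; rewrite big_mkord sumEFin lee_fin.
Qed.

Lemma nneseries_lb (u : nat -> R) N : (forall n, 0 <= u n) ->
  ((\sum_(i < N) u i)%:E <= \sum_(n <oo) (u n)%:E)%E.
Proof.
move=> u0; rewrite -sumEFin -(big_mkord xpredT (fun i => (u i)%:E)).
by apply: nneseries_lim_ge => n _ _; rewrite lee_fin.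
Qed.

Lemma sum_expR_le (l : R) N : 0 < l ->
  \sum_(i < N) expR (- (l * i%:R)) <= (1 - expR (- l))^-1.
Proof.
move=> l0; have r1 : expR (- l) < 1 by rewrite expR_lt1 oppr_lt0.
have r0 := expR_ge0 (- l).
rewrite (eq_bigr (fun i : 'I_N => expR (- l) ^+ i)) => [|i _]; last first.
  by rewrite -expRM_natr mulNr.
have := subrX1 (expR (- l)) N; rewrite -opprB -[in RHS]opprB !mulNr => /oppr_inj e.
rewrite -div1r ler_pdivlMr ?subr_gt0// mulrC -e.
by rewrite gerBl exprn_ge0.
Qed.

End SeriesBounds.

(** * Overlap of the two distributions on words *)

Section Overlap.
Context (R : realType) (Q S : finType) (H : hmm R Q S) (pi1 pi2 : init_dist R Q).
Local Notation M := (word_mx H).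
Local Notation state := ('I_#|Q|).
Local Notation mass := (mass H).
Local Notation T0 := (init_support pi1).

Fixpoint hits (Z : pred (seq S)) (u w : seq S) : bool :=
  Z u || (if w is a :: v then hits Z (rcons u a) v else false).

Lemma hits_prefix Z u w k : ~~ hits Z u w -> (k <= size w)%N -> ~~ Z (u ++ take k w).
Proof.
elim: w u k => [|a w IH] u k /=; rewrite negb_or => /andP[Zu].
  by rewrite cats0.
move=> nh; case: k => [|k kw]; first by rewrite take0 cats0.
by rewrite /= -cat_rcons; apply: IH.
Qed.

(** Optional stopping: h is superharmonic and t harmonic along words, and h is
at most kappa t at the first prefix in Z. *)
Lemma sum_hits (Z : pred (seq S)) (h t : seq S -> R) kappa :
  (forall u, 0 <= h u) ->
  (forall u n, \sum_(w <- words S n) h (u ++ w) <= h u) ->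
  (forall u, \sum_a t (rcons u a) = t u) -> (forall u, 0 <= t u) -> 0 <= kappa ->
  (forall u, Z u -> h u <= kappa * t u) ->
  forall n u, \sum_(w <- words S n | hits Z u w) h (u ++ w) <= kappa * t u.
Proof.
move=> h0 hsup tharm t0 k0 Zh; elim=> [|n IH] u.
  rewrite /= big_mkcond big_seq1 /= orbF cats0; case: ifP => [/Zh//|_].
  by rewrite mulr_ge0.
have [Zu|nZu] := boolP (Z u).
  apply: le_trans (Zh u Zu); apply: le_trans (hsup u n.+1).
  by rewrite big_mkcond; apply: ler_sum => w _; case: ifP.
rewrite big_mkcond sum_wordsS -tharm mulr_sumr; apply: ler_sum => a _.
apply: le_trans (IH (rcons u a)); rewrite [leRHS]big_mkcond; apply: ler_sum => w _.
by rewrite /= (negbTE nZu) /= cat_rcons.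
Qed.

Definition overlap n := \sum_(w <- words S n) Num.min (mass pi1 w) (mass pi2 w).

Lemma sum_mass_rcons mu u : \sum_a mass mu (rcons u a) = mass mu u.
Proof.
rewrite -(sum_mass_cat H mu u 1) sum_wordsS; apply: eq_bigr => a _.
by rewrite /= big_seq1 cats1.
Qed.

Lemma sum_min_le (I : Type) (r : seq I) (f g : I -> R) :
  \sum_(i <- r) Num.min (f i) (g i) <= Num.min (\sum_(i <- r) f i) (\sum_(i <- r) g i).
Proof.
by rewrite le_min; apply/andP; split; apply: ler_sum => i _; rewrite ge_min lexx ?orbT.
Qed.

Lemma overlap_cat u n :
  \sum_(w <- words S n) Num.min (mass pi1 (u ++ w)) (mass pi2 (u ++ w)) <=
  Num.min (mass pi1 u) (mass pi2 u).
Proof. by apply: le_trans (sum_min_le _ _ _) _; rewrite !sum_mass_cat. Qed.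

Lemma overlap_nonincreasing m n : (m <= n)%N -> overlap n <= overlap m.
Proof.
move=> mn; rewrite /overlap -(subnKC mn) sum_words_cat; apply: ler_sum => u _.
exact: overlap_cat.
Qed.

(** Stop when the ratio first leaves the interval [a, b].  Below a, the smaller
probability is at most a times the second one; above b, it is at most 1 / b
times the first one; so sum_hits bounds both contributions. *)
Lemma overlap_le_range (a b : R) n : 0 < a -> 0 < b ->
  overlap n <= a + b^-1 + \sum_(w <- words S n |
    `[< forall k, (k <= n)%N -> a <= word_ratio H pi1 pi2 (take k w) <= b >]) mass pi2 w.
Proof.
move=> a0 b0; pose h u := Num.min (mass pi1 u) (mass pi2 u).
have h0 u : 0 <= h u by rewrite le_min !mass_ge0.
pose Z1 u := mass pi1 u < a * mass pi2 u.
pose Z2 u := b * mass pi2 u < mass pi1 u.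
have s1 : \sum_(w <- words S n | hits Z1 [::] w) h w <= a.
  rewrite -[leRHS]mulr1 -(mass_nil H pi2).
  apply: (@sum_hits Z1 h (mass pi2) a h0 (@overlap_cat)) => //.
  - exact: sum_mass_rcons.
  - exact: mass_ge0.
  - exact: ltW.
  - by move=> u Zu; rewrite ge_min (ltW Zu).
have s2 : \sum_(w <- words S n | hits Z2 [::] w) h w <= b^-1.
  rewrite -[leRHS]mulr1 -(mass_nil H pi1).
  apply: (@sum_hits Z2 h (mass pi1) b^-1 h0 (@overlap_cat)) => //.
  - exact: sum_mass_rcons.
  - exact: mass_ge0.
  - by rewrite invr_ge0 ltW.
  - by move=> u Zu; rewrite ge_min [b^-1 * _]mulrC !ler_pdivlMr// ![_ * b]mulrC (ltW Zu) orbT.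
apply: le_trans (lerD (lerD s1 s2) (lexx _)).
rewrite [X in X + _ + _]big_mkcond [X in _ + X + _]big_mkcond [X in _ + X]big_mkcond.
rewrite -!big_split /overlap /= big_seq [leRHS]big_seq; apply: ler_sum => w.
rewrite mem_words => /eqP wn; rewrite -/(h w).
have [_|n1] := boolP (hits Z1 [::] w).
  by rewrite -addrA lerDl addr_ge0//; case: ifP; rewrite ?mass_ge0.
have [_|n2] := boolP (hits Z2 [::] w).
  by rewrite add0r lerDl; case: ifP; rewrite ?mass_ge0.
rewrite !add0r; case: asboolP => [_|nr]; first by rewrite ge_min lexx orbT.
rewrite /h; have [->|p20] := eqVneq (mass pi2 w) 0; first by rewrite ge_min lexx orbT.
case: nr => k kn.
have p2k : 0 < mass pi2 (take k w).
  apply: (@lt_le_trans _ _ (mass pi2 w)); first by rewrite lt_neqAle eq_sym p20 mass_ge0.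
  by rewrite -{1}(cat_take_drop k w) mass_cat_le1.
rewrite -wn in kn; have := hits_prefix n1 kn; have := hits_prefix n2 kn.
by rewrite /= /Z1 /Z2 -!leNgt /word_ratio ler_pdivlMr// ler_pdivrMr// => -> ->.
Qed.

Definition local_overlap n (x : state * {set state}) :=
  \sum_(w <- words S n) Num.min (set_mass H x.2 w) (row_mass H w x.1).

Lemma local_overlap_le u q : 0 < mass_at H pi2 u q ->
  exists2 c : R, 0 < c &
    forall n, c * local_overlap n (q, step H T0 u) <= overlap (size u + n).
Proof.
move=> uq; have [c1 c10 Tc] := mass_cat_ge H pi1 u.
exists (Num.min c1 (mass_at H pi2 u q)) => [|n]; first by rewrite lt_min c10.
set c := Num.min _ _; have c0 : 0 < c by rewrite lt_min c10.
apply: (@le_trans _ _ (\sum_(w <- words S n)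
    Num.min (mass pi1 (u ++ w)) (mass pi2 (u ++ w)))).
  rewrite mulr_sumr; apply: ler_sum => w _; rewrite le_min; apply/andP; split.
    apply: le_trans (Tc w); apply: ler_pM; rewrite ?(ltW c0)//.
    - by rewrite le_min set_mass_ge0 row_mass_ge0.
    - by rewrite ge_min lexx.
    - by rewrite ge_min lexx.
  apply: le_trans (mass_at_row_mass_le H pi2 u w q); apply: ler_pM; rewrite ?(ltW c0)//.
  - by rewrite le_min set_mass_ge0 row_mass_ge0.
  - by rewrite ge_min lexx orbT.
  - by rewrite ge_min lexx orbT.
rewrite /overlap sum_words_cat.
have : u \in words S (size u) by rewrite mem_words.
move: (words S (size u)) => s; elim: s => // v s IH.
have F0 v' : 0 <= \sum_(w <- words S n)
    Num.min (mass pi1 (v' ++ w)) (mass pi2 (v' ++ w)).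
  by rewrite sumr_ge0// => w _; rewrite le_min !mass_ge0.
rewrite inE big_cons => /orP[/eqP<-|/IH us]; first by rewrite lerDl sumr_ge0.
by rewrite (le_trans us)// lerDr.
Qed.

(** The inequality of the means for l^-1 times the minimum and l times the
maximum. *)
Lemma powR_half_le (x y l : R) : 0 < l -> 0 <= x -> 0 <= y ->
  x `^ 2^-1 * y `^ 2^-1 <= l^-1 * Num.min x y + l * (x + y).
Proof.
move=> l0 x0 y0; rewrite -powRM//.
wlog xy : x y x0 y0 / x <= y => [hw|].
  by case/orP: (le_total x y) => xy; [exact: hw|rewrite mulrC minC (addrC x); exact: hw].
rewrite min_l// powR12_sqrt ?mulr_ge0//.
have li0 : 0 < l^-1 by rewrite invr_gt0.
have lx0 : 0 <= l^-1 * x by rewrite mulr_ge0// ltW.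
have ly0 : 0 <= l * y by rewrite mulr_ge0// ltW.
apply: (@le_trans _ _ (l^-1 * x + l * y)); last first.
  by rewrite lerD2l mulrDr lerDr mulr_ge0// ltW.
rewrite -[leRHS]ger0_norm ?addr_ge0// -sqrtr_sqr ler_sqrt ?sqr_ge0//.
have -> : x * y = (l^-1 * x) * (l * y) by field; rewrite gt_eqF.
nra.
Qed.

Lemma entry_affinity_half_le (l : R) m x : 0 < l ->
  entry_affinity H 2^-1 m x <=
  #|Q|%:R * (l^-1 * local_overlap m x + l * (#|Q|%:R + 1)).
Proof.
move=> l0; apply: (@le_trans _ _ (#|Q|%:R * \sum_(w <- words S m)
    (l^-1 * Num.min (set_mass H x.2 w) (row_mass H w x.1) +
     l * (set_mass H x.2 w + row_mass H w x.1)))); last first.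
  rewrite ler_wpM2l// big_split/= -!mulr_sumr lerD2l ler_pM2l// big_split/=.
  by rewrite sum_words_row_mass lerD2r sum_words_set_mass.
rewrite /entry_affinity mulr_sumr; apply: ler_sum => w _.
have -> : (1 - 2^-1 : R) = 2^-1 by field.
apply: (@le_trans _ _ (\sum_(q : state)
    set_mass H x.2 w `^ 2^-1 * row_mass H w x.1 `^ 2^-1)).
  apply: ler_sum => q _; rewrite ler_wpM2l ?powR_ge0// ge0_ler_powR ?nnegrE//.
  - exact: word_mx_ge0.
  - exact: row_mass_ge0.
  - exact: word_mx_le_row_mass.
rewrite sumr_const card_ord -[leLHS]mulr_natl ler_wpM2l//.
by rewrite powR_half_le ?set_mass_ge0 ?row_mass_ge0.
Qed.

(** If the overlap tends to 0, so does the overlap seen from every pair that can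
be reached, hence the moment of order 1/2 over a long enough block is at most
1/2 from each of these finitely many pairs. *)
Lemma affinity_half_decay :
  (forall eps : R, 0 < eps -> exists n, overlap n < eps) ->
  exists2 m, (0 < m)%N & forall n u q, 0 < mass_at H pi2 u q ->
    affinity H 2^-1 n (q, step H T0 u) <= (2^-1) ^+ (n %/ m) * (#|Q|%:R + 1).
Proof.
move=> ov0; pose X x := exists u q, 0 < mass_at H pi2 u q /\ x = (q, step H T0 u).
have Xcl : succ_closed H X.
  move=> x w q [u [q' [uq' ->]]] /= Mq; exists (u ++ w), q.
  rewrite /succ_state /= -step_cat; split=> //; rewrite !mass_at_gt0 in uq' *.
  by rewrite step_cat inE; apply/existsP; exists q'; rewrite uq'.
pose D : R := #|Q|%:R + 1; have D0 : 0 < D by rewrite ltr_wpDl.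
have DQ : #|Q|%:R <= D by rewrite lerDl.
(* With this l, and a local overlap at most l / (4 D), both terms of
   entry_affinity_half_le contribute at most 1/4. *)
have [l l0 lE] : exists2 l, 0 < l & l = (4 * D * D)^-1.
  by exists (4 * D * D)^-1 => //; rewrite invr_gt0 !mulr_gt0.
have /choice[N HN] : forall x, exists N, X x -> forall m, (N <= m)%N ->
    entry_affinity H 2^-1 m x <= 2^-1.
  move=> x; have [[u [q [uq ->]]]|] := pselect (X x); last by exists 0%N.
  have [c c0 ovc] := local_overlap_le uq.
  have [|n0 Hn0] := ov0 (c * l / (4 * D)).
    by rewrite divr_gt0 ?mulr_gt0.
  exists n0 => _ m mn0; apply: le_trans (entry_affinity_half_le _ _ l0) _.
  have lo : local_overlap m (q, step H T0 u) <= l / (4 * D).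
    rewrite -(ler_pM2l c0); apply: le_trans (ovc m) _.
    rewrite mulrA; apply: le_trans (overlap_nonincreasing _) (ltW Hn0).
    by rewrite (leq_trans mn0)// leq_addl.
  apply: (@le_trans _ _ (D * (l^-1 * (l / (4 * D)) + l * D))).
    have ? : 0 <= local_overlap m (q, step H T0 u).
      by rewrite sumr_ge0// => w _; rewrite le_min set_mass_ge0 row_mass_ge0.
    apply: ler_pM => //.
      have li0 : 0 <= l^-1 by rewrite invr_ge0 ltW.
      by apply: addr_ge0; apply: mulr_ge0 => //; exact: ltW.
    by rewrite lerD2r ler_pM2l ?invr_gt0.
  rewrite lE le_eqVlt; apply/orP; left; apply/eqP; field.
  by rewrite gt_eqF.
have [m0 Hm0] := finite_bound N; exists m0.+1 => // n u q uq.
apply: (@affinity_decay _ _ _ H X 2^-1 m0.+1 2^-1) => //; last by exists u, q.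
  by rewrite invr_gt0 ltr0n invf_lt1// ltr1n.
move=> x Xx; apply: HN => //; exact: leq_trans (Hm0 x) _.
Qed.

End Overlap.

(** * Extended logarithms and convergence in the extended reals *)

Section ExtendedLog.
Context (R : realType).

Lemma lne_le_EFin (x y : R) : 0 <= x -> (lne x%:E <= y%:E)%E = (x <= expR y).
Proof.
move=> x0; rewrite -lee_expeR lneK ?lee_fin//.
by rewrite in_itv/= leey andbT lee_fin.
Qed.

Lemma EFin_le_lne (x y : R) : 0 <= x -> (y%:E <= lne x%:E)%E = (expR y <= x).
Proof.
move=> x0; rewrite -lee_expeR lneK ?lee_fin//.
by rewrite in_itv/= leey andbT lee_fin.
Qed.

Lemma cvge_limn (u : (\bar R)^nat) l :
  (u @ \oo --> l) <-> (limn_esup u = l /\ limn_einf u = l).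
Proof.
split=> [ul|[us ui]]; first by have [? ?] := cvg_limn_einf_sup ul.
have cs : esups u @ \oo --> l by rewrite -us limn_esup_lim; exact: is_cvg_esups.
have ci : einfs u @ \oo --> l by rewrite -ui limn_einf_lim; exact: is_cvg_einfs.
apply: (squeeze_cvge _ ci cs); apply: nearW => n; apply/andP; split.
  by apply: ereal_inf_lbound; exists n => /=.
by apply: ereal_sup_ubound; exists n => /=.
Qed.

Lemma measurable_cvge d (T : measurableType d) (f : (T -> \bar R)^nat)
    (l : \bar R) :
  (forall n, measurable_fun setT (f n)) ->
  measurable [set x | f n x @[n --> \oo] --> l].
Proof.
move=> mf; rewrite (_ : [set x | _] =
    [set x | limn_esup (f ^~ x) = l] `&` [set x | limn_esup (fun n => - f n x)%E = - l]%E).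
  apply: measurableI.
    rewrite -[X in measurable X]setTI.
    exact: (measurable_fun_limn_esup mf measurableT (emeasurable_set1 l)).
  rewrite -[X in measurable X]setTI.
  have mNf n : measurable_fun setT (fun x => (- f n x)%E) by exact: measurableT_comp.
  exact: (measurable_fun_limn_esup mNf measurableT (emeasurable_set1 (- l)%E)).
apply/seteqP; split=> x /=.
  by move=> /cvge_limn[ul il]; split => //; rewrite -il /limn_einf oppeK.
by move=> [ul il]; apply/cvge_limn; split => //; rewrite /limn_einf il oppeK.
Qed.

End ExtendedLog.

(** * The exponent event and the decision time *)

Section Exponents.
Context (R : realType) (Q S : finType) (H : hmm R Q S) (pi1 pi2 : init_dist R Q).
Context (P : probability (run_space H pi2) R) (hP : is_run_measure P).
Local Notation run := (run_space H pi2).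
Local Notation pr := (pr P).
Local Notation above := (@above R Q S H pi1 pi2).
Local Notation eventually_below := (@eventually_below R Q S H pi1 pi2).
Local Notation L r n := (word_ratio H pi1 pi2 (segment r 0 n)).

Lemma likelihood_ratio_word (r : run) n :
  likelihood_ratio H pi1 pi2 n (emitted r) = L r n.
Proof. by rewrite /likelihood_ratio !norm1_mass. Qed.

Lemma word_ratio_nneg (r : run) n : 0 <= L r n.
Proof. exact: word_ratio_ge0. Qed.

Definition exponent_set (l : \bar R) : set run :=
  @emitted _ _ _ H pi2 @^-1` exponent_event H pi1 pi2 l.

Lemma measurable_exponent_set l : measurable (exponent_set l).
Proof.
apply: (@measurable_cvge _ _ run (fun n r =>
  ((n%:R^-1)%:E * ln_ratio H pi1 pi2 n (emitted r))%E)) => n _ Y mY.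
rewrite setTI; rewrite (_ : _ @^-1` _ =
    [set r : run | Y ((n%:R^-1)%:E * lne (L r n)%:E)%E]).
  exact: (measurable_segment 0 n
    (fun w => Y ((n%:R^-1)%:E * lne (word_ratio H pi1 pi2 w)%:E)%E)).
by apply/seteqP; split=> r /=; rewrite /ln_ratio likelihood_ratio_word.
Qed.

Lemma exponent_set_lt l (theta : R) r : (l < theta%:E)%E -> exponent_set l r ->
  exists N, forall n, (N <= n)%N -> L r n <= expR (theta * n%:R).
Proof.
move=> lt rl; have := rl _ (open_nbhs_nbhs (conj (@open_ereal_lt_ereal R theta%:E) lt)).
move=> [N _ HN]; exists N.+1 => n Nn.
have n0 : 0 < n%:R :> R by rewrite ltr0n (leq_trans _ Nn).
have /= := HN n (ltnW Nn); rewrite lte_pdivrMl// => /ltW.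
by rewrite /ln_ratio likelihood_ratio_word -EFinM lne_le_EFin ?word_ratio_nneg// mulrC.
Qed.

Lemma exponent_set_gt l (theta : R) r : (theta%:E < l)%E -> exponent_set l r ->
  exists N, forall n, (N <= n)%N -> expR (theta * n%:R) <= L r n.
Proof.
move=> lt rl; have := rl _ (open_nbhs_nbhs (conj (@open_ereal_gt_ereal R theta%:E) lt)).
move=> [N _ HN]; exists N.+1 => n Nn.
have n0 : 0 < n%:R :> R by rewrite ltr0n (leq_trans _ Nn).
have /= := HN n (ltnW Nn); rewrite lte_pdivlMl// => /ltW.
by rewrite /ln_ratio likelihood_ratio_word -EFinM EFin_le_lne ?word_ratio_nneg// mulrC.
Qed.

Lemma exponent_set_eventually l (theta : R) : (l < theta%:E)%E ->
  exponent_set l `<=` eventually_below theta.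
Proof. by move=> lt r /(exponent_set_lt lt)[N HN]; exists N. Qed.

Definition undecided (alpha beta : R) (n : nat) : set run :=
  [set r | alpha / (1 - beta) <= L r n <= (1 - alpha) / beta].

Definition undecided_upto alpha beta n : set run :=
  \bigcap_(k in [set k | (k <= n)%N]) undecided alpha beta k.

Lemma measurable_undecided alpha beta n : measurable (undecided alpha beta n).
Proof.
exact: (measurable_segment 0 n (fun w => alpha / (1 - beta) <=
  word_ratio H pi1 pi2 w <= (1 - alpha) / beta)).
Qed.

Lemma measurable_undecided_upto alpha beta n : measurable (undecided_upto alpha beta n).
Proof.
apply: bigcap_measurable => [|k _]; first by exists 0%N.
exact: measurable_undecided.
Qed.

(** The test lasts longer than n exactly on undecided_upto n.  The logarithms
disappear because the thresholds of L are the exponentials of those of ln L. *)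
Lemma cond_sprt_timeE l alpha beta : 0 < alpha < 1 -> 0 < beta < 1 ->
  cond_sprt_time pi1 P l alpha beta =
  ((\sum_(n <oo) (pr (exponent_set l `&` undecided_upto alpha beta n))%:E) *
   ((pr (exponent_set l))%:E)^-1)%E.
Proof.
move=> /andP[a0 a1] /andP[b0 b1]; rewrite /cond_sprt_time /cond_expectation.
have mE := measurable_exponent_set l.
rewrite -/(exponent_set l) (prE P mE); congr (_ * _)%E.
rewrite -(integral_first_failure P mE (measurable_undecided alpha beta)).
apply: eq_integral => r _; rewrite /sprt_time; congr (ereal_inf [set _ | n in _]).
apply/funext => n; apply/propext.
rewrite /undecided /= /ln_ratio likelihood_ratio_word.
rewrite EFin_le_lne ?word_ratio_nneg// lne_le_EFin ?word_ratio_nneg//.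
by rewrite !lnK// posrE divr_gt0// subr_gt0.
Qed.

Lemma sum_prefix_le (c : R) N n : 0 <= c ->
  \sum_(i < N) (if (i < n)%N then c else 0) <= n%:R * c.
Proof.
move=> c0; suff -> : \sum_(i < N) (if (i < n)%N then c else 0) = (minn N n)%:R * c.
  by rewrite ler_wpM2r// ler_nat geq_minr.
elim: N => [|N IH]; first by rewrite big_ord0 min0n mul0r.
rewrite big_ord_recr /= IH; case: ltnP => Nn.
  by rewrite (minn_idPl Nn) -natr1 mulrDl mul1r.
by rewrite addr0 (minn_idPr (leqW Nn)).
Qed.

(** The first n0 terms are at most the probability of the exponent event.  The
others are deviations: the ratio exceeds e^(theta n) although its exponent l is
below theta. *)
Lemma exponent_series_bounded l (theta : R) : (l < theta%:E)%E ->
  exists K : R, 0 <= K /\ forall (N : nat) (A : nat -> set run) (n0 : nat),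
    (forall n, measurable (A n)) ->
    (forall n, (n0 <= n)%N -> exponent_set l `&` A n `<=` above theta n) ->
    \sum_(i < N) pr (exponent_set l `&` A i) <= n0%:R * pr (exponent_set l) + K.
Proof.
move=> lt; have [th lth tht] : exists2 th : R, (l < th%:E)%E & th < theta.
  case: l lt => [x|//|_]; last by exists (theta - 1); rewrite ?ltNyr// gtrBl.
  rewrite lte_fin => xt; exists ((x + theta) / 2); rewrite ?lte_fin; lra.
have [C [lam [C0 lam0 HC]]] := eventually_below_deviation pi1 hP tht.
have r1 : expR (- lam) < 1 by rewrite expR_lt1 oppr_lt0.
exists (C * (1 - expR (- lam))^-1); split.
  by rewrite mulr_ge0// invr_ge0 subr_ge0 ltW.
move=> N A n0 mA An; have mE := measurable_exponent_set l.
apply: (@le_trans _ _ (\sum_(i < N) ((if (i < n0)%N then pr (exponent_set l) else 0) +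
    C * expR (- (lam * i%:R))))).
  apply: ler_sum => i _; have mEA : measurable (exponent_set l `&` A i).
    exact: measurableI.
  have e0 : 0 <= C * expR (- (lam * i%:R)) by rewrite mulr_ge0 ?expR_ge0.
  have [i0|i0] := ltnP i n0; first by rewrite ler_wpDr// pr_le.
  rewrite add0r; apply: le_trans (HC i); apply: pr_le => //.
    by apply: measurableI; [exact: measurable_eventually_below|exact: measurable_above].
  move=> r [Er Ar]; split; first exact: exponent_set_eventually lth _ Er.
  by apply: An.
rewrite big_split/=; apply: lerD; last by rewrite -mulr_sumr ler_wpM2l// sum_expR_le.
by rewrite sum_prefix_le ?pr_ge0.
Qed.

Lemma word_ratio_gt0 w : 0 < word_ratio H pi1 pi2 w ->
  0 < mass H pi1 w /\ 0 < mass H pi2 w.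
Proof.
rewrite /word_ratio => w0.
have p2 : 0 < mass H pi2 w.
  rewrite lt_neqAle mass_ge0 andbT; apply: contraTneq w0 => <-.
  by rewrite invr0 mulr0 ltxx.
by split => //; move: w0; rewrite pmulr_lgt0// invr_gt0.
Qed.

Lemma word_ratio_prefix_gt0 u w : 0 < word_ratio H pi1 pi2 (u ++ w) ->
  0 < word_ratio H pi1 pi2 u.
Proof.
move=> /word_ratio_gt0[p1 p2]; apply: divr_gt0.
  exact: lt_le_trans p1 (mass_cat_le1 H pi1 u w).
exact: lt_le_trans p2 (mass_cat_le1 H pi2 u w).
Qed.

(** A positive numerator is at least a positive initial weight times a positive
matrix entry, and the denominator is at most 1. *)
Lemma word_ratio_lb : exists k c : R, [/\ 0 < k, 0 < c &
  forall w, 0 < word_ratio H pi1 pi2 w -> k * c ^+ size w <= word_ratio H pi1 pi2 w].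
Proof.
have [c /andP[c0 _] Mc] := word_mx_entry_lb H.
have [k /andP[k0 _] pk] := @finite_min_pos R _ [pred j | 0 < pi1 ord0 j]
  (fun j => pi1 ord0 j) (fun j => id).
exists k, c; split => // w /word_ratio_gt0[p1 p2].
rewrite ler_pdivlMr//; apply: (@le_trans _ _ (k * c ^+ size w)).
  by rewrite ler_piMr ?mass_le1// mulr_ge0 ?exprn_ge0// ltW.
move: p1; rewrite massE => /sumr_gt0_ex[q|q q0]; first exact: mass_at_ge0.
have /sumr_gt0_ex[j|j jq] := q0; first by rewrite mulr_ge0 ?dist_ge0 ?word_mx_ge0.
rewrite (bigD1 q)//= -[leLHS]addr0 lerD ?sumr_ge0// => [|k' _]; last exact: mass_at_ge0.
rewrite /mass_at (bigD1 j)//= -[leLHS]addr0 lerD ?sumr_ge0// => [|k' _]; last first.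
  by rewrite mulr_ge0 ?dist_ge0 ?word_mx_ge0.
have pj : 0 < pi1 ord0 j.
  by rewrite lt_neqAle dist_ge0 andbT; apply: contraTneq jq => <-; rewrite mul0r ltxx.
have Mj : 0 < word_mx H w j q.
  by rewrite lt_neqAle word_mx_ge0 andbT; apply: contraTneq jq => <-; rewrite mulr0 ltxx.
by apply: ler_pM; rewrite ?exprn_ge0 ?(ltW k0) ?(ltW c0) ?Mc ?pk.
Qed.

(** Undecided runs have a positive ratio, which is at least k c^n and so exceeds
e^((ln c - 1) n) for n >= n0.  Neither n0 nor the constants depend on the error
levels. *)
Lemma exit_series_Ny_bounded : exists B : R, forall alpha beta,
  0 < alpha < 1 -> 0 < beta < 1 ->
  (\sum_(n <oo) (pr (exponent_set -oo `&` undecided_upto alpha beta n))%:E <= B%:E)%E.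
Proof.
have [k [c [k0 c0 lb]]] := word_ratio_lb.
pose theta := ln c - 1.
have [K [K0 HK]] := exponent_series_bounded (ltNyr theta : (-oo < theta%:E)%E).
have [n0 Hn0] := expR_eventually_ge (k^-1 + 1) (@ltr01 R).
exists (n0%:R * pr (exponent_set -oo) + K) => alpha beta /andP[a0 a1] /andP[b0 b1].
apply: nneseries_ub => [n|N]; first exact: pr_ge0.
apply: HK => [n|n nn0 r [_ ru]]; first exact: measurable_undecided_upto.
have /andP[aL _] := ru n (leqnn n).
have L0 : 0 < L r n by apply: lt_le_trans aL; rewrite divr_gt0// subr_gt0.
apply: (@lt_le_trans _ _ (k * c ^+ n)); last by have := lb _ L0; rewrite size_segment.
have -> : expR (theta * n%:R) = c ^+ n / expR (1 * n%:R).
  by rewrite /theta mulrBl expRB (expRM_natr n (ln c)) lnK.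
rewrite ltr_pdivrMr ?expR_gt0// mulrAC -[ltLHS]mul1r ltr_pM2r ?exprn_gt0//.
rewrite mulrC -ltr_pdivrMr// div1r; apply: lt_le_trans (Hn0 n nn0).
by rewrite ltrDl.
Qed.

(** With th slightly above x, undecided runs deviate as soon as n > ln alpha / th,
and ln alpha / th is close to ln alpha / x. *)
Lemma exit_series_upper (x eps : R) : x < 0 -> 0 < pr (exponent_set x%:E) -> 0 < eps ->
  exists2 delta : R, 0 < delta <= 1 & forall alpha beta, 0 < alpha < delta -> 0 < beta < 1 ->
  (\sum_(n <oo) (pr (exponent_set x%:E `&` undecided_upto alpha beta n))%:E <=
   ((1 + eps) * (ln alpha / x) * pr (exponent_set x%:E))%:E)%E.
Proof.
move=> x0 p0 eps0; set p := pr _ in p0 *.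
pose th := x / (1 + eps / 2).
have e2 : 0 < 1 + eps / 2 by lra.
have th0 : th < 0 by rewrite pmulr_llt0 ?invr_gt0.
have xth : x < th by rewrite /th ltr_pdivlMr// mulrDr mulr1 gtrDl; nra.
have xthE : (x%:E < th%:E)%E by rewrite lte_fin.
have [K [K0 HK]] := exponent_series_bounded xthE.
(* Above Y, the excess p + K is at most the fraction eps / 2 of the main term. *)
pose Y := 2 * (p + K) / (eps * p).
have Y0 : 0 < Y by rewrite divr_gt0 ?mulr_gt0// ltr_wpDr.
exists (expR (x * Y)).
  by rewrite expR_gt0 expR_le1 nmulr_rle0// ltW.
move=> alpha beta /andP[a0 ad] /andP[b0 b1].
have lnad : ln alpha < x * Y by rewrite -[ltRHS]expRK ltr_ln ?posrE ?expR_gt0.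
have lamY : Y < ln alpha / x by rewrite ltr_ndivlMr// mulrC.
pose n0 := (Num.trunc (ln alpha / th)).+1.
have thE : ln alpha / th = (1 + eps / 2) * (ln alpha / x).
  rewrite /th; field.
  by rewrite (lt_eqF x0) gt_eqF// addr_gt0.
have lam0 : 0 < ln alpha / x by apply: lt_trans lamY.
have n0le : n0%:R <= ln alpha / th + 1.
  rewrite /n0 -natr1 lerD2r truncn_le// thE mulr_ge0// ltW//.
apply: nneseries_ub => [n|N]; first exact: pr_ge0.
apply: (@le_trans _ _ (n0%:R * p + K)).
  apply: HK => [n|n nn0 r [_ ru]]; first exact: measurable_undecided_upto.
  have /andP[aL _] := ru n (leqnn n).
  apply: lt_le_trans aL; apply: (@lt_le_trans _ _ alpha); last first.
    by rewrite ler_pdivlMr ?subr_gt0// ler_piMr 1?ltW// gtrBl.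
  rewrite -[ltRHS]lnK ?posrE// ltr_expR mulrC -ltr_ndivrMr//.
  apply: lt_le_trans (truncnS_gt _) _; by rewrite ler_nat.
apply: (@le_trans _ _ ((ln alpha / th + 1) * p + K)).
  by rewrite lerD2r ler_wpM2r// ltW.
rewrite thE; set lam := ln alpha / x in lam0 lamY *.
have : p + K <= eps / 2 * lam * p.
  have := ltW lamY; rewrite /Y ler_pdivrMr ?mulr_gt0// => h; lra.
lra.
Qed.

(** Unlike convergence of the rates, this condition constrains all times at
once, and it weakens as m grows. *)
Definition tube (x : R) (m : nat) : set run :=
  [set r | forall n, expR (- m%:R + x * n%:R) <= L r n <= expR m%:R].

Lemma measurable_tube x m : measurable (tube x m).
Proof.
rewrite (_ : tube x m = \bigcap_n
    [set r | expR (- m%:R + x * n%:R) <= L r n <= expR m%:R]).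
  apply: bigcapT_measurable => n.
  exact: (measurable_segment 0 n (fun w => expR (- m%:R + x * n%:R) <=
    word_ratio H pi1 pi2 w <= expR m%:R)).
by apply/seteqP; split=> r h n; [move=> _; exact: h|exact: h].
Qed.

Lemma tube_nondecreasing x m m' : (m <= m')%N -> tube x m `<=` tube x m'.
Proof.
move=> mm r rt n; have /andP[lo hi] := rt n; apply/andP; split.
  by apply: le_trans lo; rewrite ler_expR lerD2r lerN2 ler_nat.
by apply: le_trans hi _; rewrite ler_expR ler_nat.
Qed.

Lemma exponent_set_tube (x y : R) : y < x -> x < 0 ->
  exponent_set x%:E `<=` \bigcup_m tube y m.
Proof.
move=> yx x0 r rE.
have yxE : (y%:E < x%:E)%E by rewrite lte_fin.
have x0E : (x%:E < 0%:E)%E by rewrite lte_fin.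
have [N1 HN1] := exponent_set_gt yxE rE.
have [N2 HN2] := exponent_set_lt x0E rE.
have L0 n : 0 < L r n.
  apply: (word_ratio_prefix_gt0 (w := segment r n (maxn N1 n - n))).
  have := segment_cat r 0 n (maxn N1 n - n); rewrite add0n => <-.
  rewrite subnKC ?leq_maxr//.
  by apply: lt_le_trans (HN1 _ (leq_maxl _ _)); exact: expR_gt0.
have /choice[f Hf] : forall n, exists m : nat,
    expR (- m%:R + y * n%:R) <= L r n <= expR m%:R.
  move=> n; have [Na Ha] := expR_eventually_ge (L r n) (@ltr01 R).
  have [Nb Hb] := expR_eventually_ge (expR (y * n%:R) / L r n) (@ltr01 R).
  exists (maxn Na Nb); have := Ha _ (leq_maxl Na Nb); have := Hb _ (leq_maxr Na Nb).
  rewrite !mul1r ler_pdivrMr// => hb ->; rewrite andbT expRD expRN mulrC.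
  by rewrite ler_pdivrMr ?expR_gt0// [leRHS]mulrC.
pose N := maxn N1 N2.
have [m Hm] := finite_bound (fun i : 'I_N => f i).
exists m => // n; have [nN|nN] := ltnP n N.
  have /andP[lo hi] := Hf n; have fm := Hm (Ordinal nN); apply/andP; split.
    by apply: le_trans lo; rewrite ler_expR lerD2r lerN2 ler_nat.
  by apply: le_trans hi _; rewrite ler_expR ler_nat.
apply/andP; split.
  apply: le_trans (HN1 n (leq_trans (leq_maxl _ _) nN)).
  by rewrite ler_expR gerDr oppr_le0.
apply: le_trans (HN2 n (leq_trans (leq_maxr _ _) nN)) _.
by rewrite mul0r ler_expR.
Qed.

(** Most of the exponent event lies in one tube of slope y close to x.  There,
for small error levels, the upper threshold is never crossed, and the lower one not before the line
- m + y n descends to the logarithm of the threshold. *)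
Lemma exit_series_lower (x eps : R) : x < 0 -> 0 < pr (exponent_set x%:E) -> 0 < eps ->
  exists2 delta : R, 0 < delta <= 1 & forall alpha beta, 0 < alpha < delta -> 0 < beta < delta ->
  (((1 - eps) * (ln alpha / x) * pr (exponent_set x%:E))%:E <=
   \sum_(n <oo) (pr (exponent_set x%:E `&` undecided_upto alpha beta n))%:E)%E.
Proof.
move=> x0 p0 eps0; set p := pr _ in p0 *.
have mE := measurable_exponent_set x%:E.
pose eta : R := Num.min 2^-1 (eps / 4).
have eta0 : 0 < eta by rewrite lt_min invr_gt0 ltr0n divr_gt0.
have eta2 : eta <= 2^-1 by rewrite ge_min lexx.
have eta4 : eta <= eps / 4 by rewrite ge_min lexx orbT.
pose y := (1 + eta) * x.
have y0 : y < 0 by rewrite /y pmulr_rlt0//; lra.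
have yx : y < x by rewrite /y mulrDl mul1r gtrDl pmulr_rlt0.
have mET m : measurable (exponent_set x%:E `\` tube y m).
  by apply: measurableD => //; exact: measurable_tube.
have [m m' mm|||m Hm] := @pr_vanishing _ _ _ P _ mET _ _ (eta * p).
- by apply: setDS; exact: tube_nondecreasing.
- apply/seteqP; split=> r // rn; have [rE _] := rn 0%N I.
  by have [m _ rm] := exponent_set_tube yx x0 rE; have [_] := rn m I.
- by rewrite mulr_gt0.
have mEt : measurable (exponent_set x%:E `&` tube y m).
  by apply: measurableI => //; exact: measurable_tube.
have pT : (1 - eta) * p <= pr (exponent_set x%:E `&` tube y m).
  have := pr_split P mE (measurable_tube y m); rewrite -/p.
  by have := Hm m (leqnn m); lra.
(* ln 2 bounds - ln (1 - beta), and m is the width of the tube: both become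
   negligible, up to the factor eta, once - ln alpha exceeds Z. *)
pose Z : R := (ln 2 + m%:R) / eta.
have ln20 : 0 < ln 2 :> R by rewrite ln_gt0// ltr1n.
have Z0 : 0 < Z by rewrite divr_gt0// ltr_wpDr.
exists (expR (- Z)).
  by rewrite expR_gt0 expR_le1 oppr_le0 ltW.
move=> alpha beta /andP[a0 ad] /andP[b0 bd].
have m0 : 0 <= m%:R :> R by [].
have ZZ : ln 2 + m%:R <= Z.
  by rewrite /Z ler_pdivlMr// ler_piMr ?addr_ge0 ?(ltW ln20)//; lra.
have small z : 0 < z -> z < expR (- Z) -> z < 2^-1 * expR (- m%:R).
  move=> z0 zZ; apply: lt_le_trans zZ _; apply: (@le_trans _ _ (expR (- (ln 2 + m%:R)))).
    by rewrite ler_expR lerN2.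
  by rewrite opprD expRD expRN lnK ?posrE ?ltr0n.
have am := small _ a0 ad; have bm := small _ b0 bd.
have em1 : expR (- m%:R) <= 1 :> R by rewrite expR_le1 oppr_le0.
have a2 : alpha < 2^-1 by have := expR_gt0 (- m%:R : R); nra.
have b2 : beta < 2^-1 by have := expR_gt0 (- m%:R : R); nra.
have lnaZ : ln alpha < - Z by rewrite -[ltRHS]expRK ltr_ln ?posrE ?expR_gt0.
pose w := (ln alpha + ln 2 + m%:R) / y.
have w0 : 0 <= w by rewrite ler_ndivlMr// mul0r; lra.
pose n1 := (Num.trunc w).+1.
apply: le_trans (nneseries_lb n1 _) => [|n]; last exact: pr_ge0.
rewrite lee_fin; apply: (@le_trans _ _ (\sum_(i < n1) (1 - eta) * p)); last first.
  apply: ler_sum => i _; apply: le_trans pT _; apply: pr_le => //.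
    by apply: measurableI => //; exact: measurable_undecided_upto.
  apply: setIS => r rt k ki; have /andP[lo hi] := rt k.
  have kw : k%:R <= w.
    apply: (@le_trans _ _ (Num.trunc w)%:R); last by rewrite truncn_le.
    by rewrite ler_nat (leq_trans ki)// -ltnS.
  apply/andP; split.
    apply: le_trans lo; apply: (@le_trans _ _ (expR (ln alpha + ln 2))).
      rewrite expRD !lnK ?posrE ?ltr0n//.
      by rewrite ler_pdivrMr ?subr_gt0 1?(lt_trans b2) ?invf_lt1 ?ltr1n//; nra.
    rewrite ler_expR; move: kw; rewrite /w ler_ndivlMr//; lra.
  apply: le_trans hi _; rewrite ler_pdivlMr//.
  have : expR m%:R * beta <= 2^-1.
    rewrite mulrC -ler_pdivlMr ?expR_gt0// -expRN; exact: ltW.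
  lra.
rewrite sumr_const card_ord -[leRHS]mulr_natl mulrA ler_wpM2r ?(ltW p0)//.
apply: (@le_trans _ _ (w * (1 - eta))); last first.
  by rewrite ler_wpM2r ?subr_ge0; [|lra|exact/ltW/truncnS_gt].
set lam := ln alpha / x.
have lamE : ln alpha = lam * x by rewrite /lam divfK// lt_eqF.
have hl : (ln 2 + m%:R) <= eta * lam * - x.
  by move: lnaZ; rewrite lamE /Z -mulNr ltr_pdivlMr//; lra.
have lam0 : 0 < lam by rewrite /lam ltr_ndivlMr// mul0r; apply: lt_trans lnaZ _; rewrite oppr_lt0.
have wlam : lam * (1 - eta) / (1 + eta) <= w.
  rewrite /w lamE /y ler_ndivlMr//.
  have -> : lam * (1 - eta) / (1 + eta) * ((1 + eta) * x) = lam * (1 - eta) * x.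
    by field; lra.
  lra.
apply: (@le_trans _ _ (lam * (1 - eta) / (1 + eta) * (1 - eta))); last first.
  by rewrite ler_wpM2r// subr_ge0; lra.
rewrite mulrAC ler_pdivlMr; last by lra.
have -> : lam * (1 - eta) * (1 - eta) = ((1 - eta) * (1 - eta)) * lam by ring.
rewrite mulrAC ler_wpM2r ?(ltW lam0)//.
nra.
Qed.

(** Otherwise the moments of order 1/2 decay exponentially.  Then the ratio
exceeds e^(- d n) only with exponentially small probability, whereas a run of
exponent 0 exceeds it at all large times. *)
Lemma overlap_bounded_below : 0 < pr (exponent_set 0%E) ->
  exists2 c : R, 0 < c & forall n, c <= overlap H pi1 pi2 n.
Proof.
move=> p0; apply: contrapT => nov.
have ov0 : forall eps : R, 0 < eps -> exists n, overlap H pi1 pi2 n < eps.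
  move=> eps eps0; apply: contrapT => ge_eps; apply: nov; exists eps => // n.
  by rewrite leNgt; apply/negP => lt_eps; apply: ge_eps; exists n.
have [m m0 aff] := affinity_half_decay ov0.
have mR : 0 < m%:R :> R by rewrite ltr0n.
have ln20 : 0 < ln 2 :> R by rewrite ln_gt0// ltr1n.
pose d : R := ln 2 / m%:R; have d0 : 0 < d by rewrite divr_gt0.
pose D : R := #|Q|%:R + 1; have D0 : 0 < D by rewrite ltr_wpDl.
have half01 : 0 < (2^-1 : R) < 1 by rewrite invr_gt0 ltr0n invf_lt1// ltr1n.
have decay n : pr (above (- d) n) <=
    #|Q|%:R * (4 * D) * expR (- (d / 2 * n%:R)).
  rewrite (pr_sum_futures P 0 0 (measurable_above pi1 (- d) n)) /= big_seq1.
  apply: (@le_trans _ _ (\sum_(q < #|Q|) 4 * D * expR (- (d / 2 * n%:R)))); last first.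
    by rewrite sumr_const card_ord -[leLHS]mulr_natl mulrA.
  apply: ler_sum => q _.
  have [q0|q0] := ltP 0 (mass_at H pi2 [::] q); last first.
    apply: (@le_trans _ _ 0); last by rewrite !mulr_ge0 ?expR_ge0 ?(ltW D0).
    apply: le_trans q0; rewrite -(pr_future1 hP); apply: pr_le => //.
    - by apply: measurableI; [exact: measurable_above|exact: measurable_future].
    - exact: measurable_future.
  have := pr_above_future pi1 hP (- d) [::] q n half01; rewrite add0n => /le_trans; apply.
  have a1 := aff n [::] q q0.
  have pw : (2^-1 : R) ^+ (n %/ m) <= 2 * expR (- (d * n%:R)).
    have -> : (2^-1 : R) = expR (- ln 2) by rewrite expRN lnK ?posrE ?ltr0n.
    apply: le_trans (expR_divn _ _ m0) _; rewrite normrN gtr0_norm// lnK ?posrE ?ltr0n//.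
    by rewrite ler_pM2l ?ltr0n// mulNr /d mulrAC mulrA.
  have a2 : affinity H 2^-1 n (q, step H (init_support pi1) [::]) <=
      2 * expR (- (d * n%:R)) * D.
    by apply: le_trans a1 _; rewrite ler_wpM2r// ltW.
  have m2 : mass H pi1 [::] + mass_at H pi2 [::] q <= 2.
    by have := mass_at_le H pi2 [::] q; rewrite !mass_nil; lra.
  apply: (@le_trans _ _ (expR (- (2^-1 * - d * n%:R)) * 2 *
      (2 * expR (- (d * n%:R)) * D))).
    apply: ler_pM => //.
    - by rewrite mulr_ge0 ?expR_ge0 ?addr_ge0 ?mass_ge0 ?mass_at_ge0.
    - by rewrite sumr_ge0// => w _; rewrite mulr_ge0 ?powR_ge0.
    - by rewrite ler_wpM2l ?expR_ge0.
  have -> : expR (- (d / 2 * n%:R)) =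
      expR (- (2^-1 * - d * n%:R)) * expR (- (d * n%:R)).
    by rewrite -expRD; congr expR; field.
  by rewrite le_eqVlt; apply/orP; left; apply/eqP; ring.
have mA n : measurable (above (- d) n : set run) by exact: measurable_above.
have mI N : measurable (\bigcap_n (above (- d) (N + n)%N : set run)).
  by apply: bigcapT_measurable.
have sub : exponent_set 0%E `<=` \bigcup_N \bigcap_n above (- d) (N + n)%N.
  move=> r rE; have lt0 : ((- d / 2)%:E < 0%:E)%E by rewrite lte_fin; lra.
  have [N HN] := exponent_set_gt lt0 rE; exists N.+1 => // n _.
  apply: lt_le_trans (HN _ _); last by rewrite addSnnS leq_addr.
  by rewrite ltr_expR ltr_pM2r ?ltr0n ?addSn//; lra.
have : pr (exponent_set 0%E) <= 0; last by rewrite leNgt p0.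
rewrite -(@pr_bigcup0 _ _ _ P _ mI) => [|N].
  apply: pr_le => //; first exact: measurable_exponent_set.
  exact: bigcupT_measurable.
apply/eqP; rewrite eq_le pr_ge0 andbT; apply/ler_addgt0Pl => e e0; rewrite addr0.
have d2 : 0 < d / 2 by rewrite divr_gt0.
have [n0 Hn0] := expR_eventually_ge (#|Q|%:R * (4 * D) / e) d2.
apply: le_trans (pr_le P (mI N) (mA (N + n0)%N) _) _; first by move=> r; apply.
apply: le_trans (decay _) _; rewrite expRN ler_pdivrMr ?expR_gt0// [e * _]mulrC -ler_pdivrMr//.
by apply: Hn0; rewrite leq_addl.
Qed.

Lemma bounded_ratio_exponent (a b : R) r : 0 < a ->
  (forall n, a <= L r n <= b) -> exponent_set 0%E r.
Proof.
move=> a0 ab; have L0 n : 0 < L r n by have /andP[/(lt_le_trans a0)] := ab n.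
rewrite /exponent_set /exponent_event /=.
have -> : (fun n => ((n%:R^-1)%:E * ln_ratio H pi1 pi2 n (emitted r))%E) =
    (fun n => (n%:R^-1 * ln (L r n))%:E).
  by apply/funext => n; rewrite /ln_ratio likelihood_ratio_word lne_EFin// EFinM.
apply: cvg_EFin; first exact: nearW.
apply/cvgrPdist_le => e e0.
pose K := `|ln a| + `|ln b|.
exists (Num.trunc (K / e)).+1 => // n /= Nn.
have n0 : 0 < n%:R :> R by rewrite ltr0n (leq_trans _ Nn).
rewrite sub0r normrN normrM [`|_^-1|]ger0_norm ?invr_ge0// mulrC ler_pdivrMr//.
have /andP[lo hi] := ab n.
have b0 : 0 < b by apply: lt_le_trans hi.
apply: (@le_trans _ _ K).
  have l1 : ln a <= ln (L r n) by rewrite ler_ln ?posrE.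
  have l2 : ln (L r n) <= ln b by rewrite ler_ln ?posrE.
  have := ler_norm (- ln a); have := ler_norm (ln b); rewrite normrN.
  have := normr_ge0 (ln a); have := normr_ge0 (ln b).
  by rewrite /K ler_norml; lra.
rewrite mulrC -ler_pdivrMr// ltW//; apply: lt_le_trans (truncnS_gt _) _.
by rewrite ler_nat.
Qed.

(** A set of positive probability consists of runs that are undecided forever,
and these runs have exponent 0; so the terms of the series do not tend to 0. *)
Lemma exit_series_infinite : 0 < pr (exponent_set 0%E) ->
  exists2 t : R, 0 < t < 1 &
  (\sum_(n <oo) (pr (exponent_set 0%E `&` undecided_upto t t n))%:E = +oo)%E.
Proof.
move=> p0; have [c c0 ovc] := overlap_bounded_below p0.
have c1 : c <= 1.
  apply: le_trans (ovc 0%N) _; rewrite /overlap /= big_seq1 !mass_nil.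
  by rewrite ge_min lexx.
(* The thresholds are then a = t / (1 - t) and b = 1 / a, and the stopping bound
   loses at most a + 1 / b = 2 a <= 4 t = c / 2. *)
pose t := c / 8; have t0 : 0 < t by rewrite divr_gt0.
have t8 : t <= 8^-1 by rewrite /t ler_pdivrMr// mulVf.
have t1 : 0 < 1 - t by lra.
exists t; first by lra.
have a0 : 0 < t / (1 - t) by rewrite divr_gt0.
have b0 : 0 < (1 - t) / t by rewrite divr_gt0.
have a2 : t / (1 - t) <= 2 * t by rewrite ler_pdivrMr//; nra.
have stay n : c / 2 <= pr (undecided_upto t t n).
  have := overlap_le_range H pi1 pi2 n a0 b0; rewrite invf_div => /(le_trans (ovc n)).
  rewrite -(pr_segment hP n (fun w => `[< forall k, (k <= n)%N ->
    t / (1 - t) <= word_ratio H pi1 pi2 (take k w) <= (1 - t) / t >])).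
  rewrite (_ : [set r : run | _] = undecided_upto t t n); first by rewrite /t in a2 *; lra.
  apply/seteqP; split=> r /=.
    by move=> /asboolP h k kn; have := h k kn; rewrite take_segment.
  by move=> h; apply/asboolP => k kn; rewrite take_segment//; exact: h.
pose A : set run := \bigcap_n undecided t t n.
have mA : measurable A by apply: bigcapT_measurable => n; exact: measurable_undecided.
have AE : A `<=` exponent_set 0%E.
  by move=> r rA; apply: (bounded_ratio_exponent a0) => n; exact: rA.
have pA : c / 4 <= pr A.
  have mU n : measurable (undecided_upto t t n `\` A).
    by apply: measurableD => //; exact: measurable_undecided_upto.
  have [n m nm|||n Hn] := @pr_vanishing _ _ _ P _ mU _ _ (c / 4).
  - by apply: setSD => r rm k kn; apply: rm; exact: leq_trans kn nm.
  - apply/seteqP; split=> r // rn; have [_] := rn 0%N I; apply => k _.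
    by have [rk _] := rn k I; exact: rk (leqnn k).
  - by rewrite divr_gt0.
  have := pr_le_setD P (measurable_undecided_upto t t n) mA.
  have := Hn n (leqnn n); have := stay n; lra.
apply: eq_infty => x.
pose N := (Num.trunc (`|x| / (c / 4))).+1.
apply: le_trans (nneseries_lb N _) => [|n]; last exact: pr_ge0.
rewrite lee_fin; apply: (@le_trans _ _ (\sum_(i < N) c / 4)).
  rewrite sumr_const card_ord -[leRHS]mulr_natl -ler_pdivrMr ?divr_gt0//.
  apply: le_trans (ltW (truncnS_gt _)) => //.
  by rewrite ler_pM2r ?invr_gt0 ?divr_gt0// ler_norm.
apply: ler_sum => i _; apply: le_trans pA _; apply: pr_le => //.
  apply: measurableI; first exact: measurable_exponent_set.
  exact: measurable_undecided_upto.
by move=> r rA; split; [exact: AE|move=> k _; exact: rA].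
Qed.

Lemma likelihood_exponent_gt0 l : likelihood_exponents pi1 P l ->
  0 < pr (exponent_set l).
Proof.
move=> [_]; rewrite -/(exponent_set l) (prE P (measurable_exponent_set l)).
by rewrite lte_fin.
Qed.

Lemma cond_sprt_time_asymp l : likelihood_exponents pi1 P l ->
  (-oo < l < 0)%E ->
  asymp_equiv (cond_sprt_time pi1 P l) (fun alpha _ : R => (ln alpha / fine l)%:E).
Proof.
move=> /likelihood_exponent_gt0; case: l => [x|//|//] p0 /andP[_].
rewrite lte_fin => x0 eps eps0 /=.
have [d1 /andP[d10 d11] lo] := exit_series_lower x0 p0 eps0.
have [d2 /andP[d20 d21] up] := exit_series_upper x0 p0 eps0.
exists (Num.min d1 d2) => [|alpha beta]; first by rewrite lt_min d10.
move=> /andP[a0]; rewrite lt_min => /andP[a1 a2] /andP[b0]; rewrite lt_min => /andP[b1 b2].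
have a01 : 0 < alpha < 1 by rewrite a0 (lt_le_trans a1).
have b01 : 0 < beta < 1 by rewrite b0 (lt_le_trans b1).
have a1' : 0 < alpha < d1 by rewrite a0.
have b1' : 0 < beta < d1 by rewrite b0.
have a2' : 0 < alpha < d2 by rewrite a0.
have := lo alpha beta a1' b1'; have := up alpha beta a2' b01.
rewrite cond_sprt_timeE//; set s := (\sum_(n <oo) _)%E.
have lam0 : 0 < ln alpha / x.
  by rewrite ltr_ndivlMr// mul0r ln_lt0.
have s0 : (0 <= s)%E by apply: nneseries_ge0 => n _ _; rewrite lee_fin pr_ge0.
case: s s0 => [y|//|//] _; rewrite !lee_fin => yup ylo.
rewrite inver gt_eqF// inver gt_eqF// -!EFinM !lee_fin.
by rewrite ler_pdivlMr// ler_pdivlMr// ler_pdivrMr// ler_pdivrMr// ylo yup.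
Qed.

Lemma cond_sprt_time_infinite : likelihood_exponents pi1 P 0%E ->
  exists alpha beta : R, [/\ 0 < alpha < 1, 0 < beta < 1 &
    cond_sprt_time pi1 P 0%E alpha beta = +oo%E].
Proof.
move=> /likelihood_exponent_gt0 p0; have [t t01 tE] := exit_series_infinite p0.
exists t, t; split => //; rewrite cond_sprt_timeE// tE inver gt_eqF//.
by rewrite gt0_mulye// lte_fin invr_gt0.
Qed.

Lemma cond_sprt_time_bounded : likelihood_exponents pi1 P -oo%E ->
  (ereal_sup [set cond_sprt_time pi1 P -oo alpha beta |
     alpha in [set x : R | (0 < x < 1)%R] & beta in [set x : R | (0 < x < 1)%R]] < +oo)%E.
Proof.
move=> /likelihood_exponent_gt0 p0; have [B HB] := exit_series_Ny_bounded.
apply: (@le_lt_trans _ _ (B / pr (exponent_set -oo))%:E); last exact: ltry.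
apply: ge_ereal_sup => _ [alpha a01 [beta b01 <-]].
rewrite cond_sprt_timeE// inver gt_eqF// EFinM; apply: lee_wpmul2r; last exact: HB.
by rewrite lee_fin invr_ge0 ltW.
Qed.

End Exponents.

Theorem theorem9 (R : realType) (Q S : finType) (H : hmm R Q S)
    (pi1 pi2 : init_dist R Q)
    (P2 : probability (run_space H pi2) R) (hP2 : is_run_measure P2)
    (l : \bar R) (hl : likelihood_exponents pi1 P2 l) :
  ((-oo < l < 0)%E ->
     asymp_equiv (cond_sprt_time pi1 P2 l)
                 (fun alpha _ : R => (ln alpha / fine l)%:E)) /\
  (l = 0%E ->
     exists alpha beta : R, [/\ 0 < alpha < 1, 0 < beta < 1 &
       cond_sprt_time pi1 P2 l alpha beta = +oo%E]) /\
  (l = -oo%E ->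
     (ereal_sup [set cond_sprt_time pi1 P2 l alpha beta |
        alpha in [set x : R | (0 < x < 1)%R] & beta in [set x : R | (0 < x < 1)%R]]
      < +oo)%E).
Proof.
split; first exact: cond_sprt_time_asymp.
split=> lE; rewrite lE in hl *; first exact: cond_sprt_time_infinite.
exact: cond_sprt_time_bounded.
Qed.
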